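(* Let $\xi=(\xi_n)_{n\in\mathbb{Z}}$ be a stationary complex Gaussian process with mean $0$, unit variance, covariance matrix $(\gamma(n-m))_{n,m\in\mathbb{Z}}$, where $\gamma(n-m)=\mathbb{E}(\xi_n\overline{\xi_m})$, and such that $\mathbb{E}(\xi_n\xi_m)=0$ for all $n,m\in\mathbb{Z}$. Assume that there exists a constant $b\ge0$ such that the operator defined in $\ell^2(\mathbb{Z})$ by the bi-infinite matrix $(a_{nm})_{n,m\in\mathbb{Z}}$ given by $$a_{nm}=|\gamma(n-m)|\,|nm|^{-b}\ \text{ for } n\ne0,\ m\ne0,\qquad a_{nm}=0\ \text{ for } n=0 \text{ or } m=0,$$ is bounded. Let $f\in L^2(\mathbb{T})$. If $$\sum_{|n|\ge2}\frac{\left(\sum_{|k|\ge|n|}|\hat f(k)|^2|k|^{2b}\right)^{1/2}}{|n|(\log|n|)^{1/2}}<\infty,$$ then the random series $t\mapsto\sum_{n\in\mathbb{Z}}\hat f(n)\,\xi_n e^{2\pi i n t}$ is bounded almost surely.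
   Context: $\mathbb{T}=\mathbb{R}/\mathbb{Z}$ with normalized Lebesgue measure; $\hat f(n)=\int_{\mathbb{T}}f(t)e^{-2\pi i n t}\,dt$; indices $n,k$ range over $\mathbb{Z}$. All random variables live on a probability space $(\Omega,\mathscr{F},\mathbb{P})$, and $(\xi_n)$ is jointly Gaussian (contained in a closed subspace of $L^2(\mathbb{P})$ consisting of Gaussian variables). Unit variance means $\mathbb{E}|\xi_n|^2=1$; stationarity means $\mathbb{E}(\xi_n\overline{\xi_m})$ depends only on $n-m$. The random series is understood as the Gaussian process $\{S(t):t\in\mathbb{T}\}$, where $S(t)=\sum_{n\in\mathbb{Z}}\hat f(n)\xi_n e^{2\pi i n t}$ is the limit in $L^2(\mathbb{P})$ of the partial sums $\sum_{|n|\le N}\hat f(n)\xi_n e^{2\pi i n t}$ for each $t$ (this convergence being part of the assertion). ''Bounded almost surely'' means that this process has almost surely bounded sample paths (for a separable version; equivalently, $\sup_F\mathbb{E}\max_{t\in F}|S(t)|<\infty$, the supremum being over finite subsets $F$ of $\mathbb{T}$). *)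

(* Defs.v *)
(* Complex-valued measurability and integration are componentwise, and |z| is
   the real-valued normc z.  Functions and processes on the circle R/Z are
   1-periodic functions of a real variable, integrated over `[0, 1[. *)
From HB Require Import structures.
From mathcomp Require Import all_boot all_order all_algebra.
From mathcomp Require Import all_classical all_reals all_analysis.
From mathcomp.real_closed Require Import complex.

Set Implicit Arguments.
Unset Strict Implicit.
Unset Printing Implicit Defensive.

Import Order.TTheory GRing.Theory Num.Theory.
Import numFieldNormedType.Exports.
Export ComplexField.Normc(normc).

Local Open Scope classical_set_scope.
Local Open Scope complex_scope.
Local Open Scope ring_scope.

Section ComplexL2.
Context d (T : measurableType d) (R : realType).
Implicit Types (mu : {measure set T -> \bar R}) (D : set T) (X : T -> R[i]).

Definition cmeasurable D X :=
  measurable_fun D (fun w => complex.Re (X w)) /\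
  measurable_fun D (fun w => complex.Im (X w)).

Definition cintegral mu D X : R[i] :=
  Rintegral mu D (fun w => complex.Re (X w)) +i*
  Rintegral mu D (fun w => complex.Im (X w)).

Definition L2 mu D X :=
  cmeasurable D X /\
  (\int[mu]_(w in D) (normc (X w) ^+ 2)%:E < +oo)%E.

Definition L2_cvg mu (X_ : nat -> T -> R[i]) X :=
  [/\ forall N, L2 mu setT (X_ N), L2 mu setT X &
      (fun N => \int[mu]_w (normc (X_ N w - X w) ^+ 2)%:E)%E @ \oo --> 0%E].

(* The elements of H are functions, not classes: closedness under L2 limits
   makes H stable under almost everywhere equality. *)
Definition closed_L2_subspace mu (H : set (T -> R[i])) :=
  [/\ forall X, H X -> L2 mu setT X,
      H (cst 0),
      forall (c : R[i]) X Y, H X -> H Y -> H (fun w => c * X w + Y w) &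
      forall (X_ : nat -> T -> R[i]) X, (forall N, H (X_ N)) -> L2_cvg mu X_ X -> H X].

End ComplexL2.

Section Gaussian.
Context d (Omega : measurableType d) (R : realType) (P : probability Omega R).

Definition cexpectation (X : Omega -> R[i]) : R[i] := cintegral P setT X.

(* Degenerate (constant) Gaussian variables are allowed; they need a separate
   clause because the library's normal_prob m 0 is not the Dirac mass at m. *)
Definition gaussian (X : Omega -> R) :=
  measurable_fun setT X /\
  exists m s : R, forall A : set R, measurable A ->
    P (X @^-1` A) = if s == 0 then \d_m A else normal_prob m s A.

(* Real and imaginary parts are jointly Gaussian. *)
Definition complex_gaussian (X : Omega -> R[i]) :=
  forall a b : R,
    gaussian (fun w => a * complex.Re (X w) + b * complex.Im (X w)).

Definition jointly_gaussian (I : Type) (xi : I -> Omega -> R[i]) :=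
  exists H : set (Omega -> R[i]),
    [/\ closed_L2_subspace P H,
        forall X, H X -> complex_gaussian X &
        forall i, H (xi i)].

(* Separability: outside a null set, the whole path is determined, through
   limits, by its restriction to a fixed countable set of times. *)
Definition separable_process (S : R -> Omega -> R[i]) :=
  exists2 D : set R, countable D &
    \forall w \ae P, forall t : R, exists u : nat -> R,
      [/\ forall k, D (u k),
          u @ \oo --> t &
          (fun k => normc (S (u k) w - S t w)) @ \oo --> (0 : R)].

Definition circle_process (S : R -> Omega -> R[i]) :=
  forall w, periodic (S ^~ w) 1.

(* Some separable version of S has almost surely bounded paths: the paths of S
   itself may be modified on a null set depending on t. *)
Definition bounded_almost_surely (S : R -> Omega -> R[i]) :=
  exists S' : R -> Omega -> R[i],
    [/\ circle_process S',
        forall t, cmeasurable setT (S' t),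
        forall t, \forall w \ae P, S' t w = S t w,
        separable_process S' &
        \forall w \ae P, exists M : R, forall t, normc (S' t w) <= M].

End Gaussian.

(* The sum of u n over the integers n with |n| <= N. *)
Definition sym_sum (V : zmodType) (u : int -> V) (N : nat) : V :=
  \sum_(k < N.*2.+1) u (k%:Z - N%:Z).

Section Sequences.
Context (R : realType).

Definition l2_sqnorm (x : int -> R[i]) : \bar R :=
  \esum_(n in [set: int]) (normc (x n) ^+ 2)%:E.

(* x |-> (sum_m A n m * x m)_n is everywhere defined on l2(Z) and bounded
   from l2(Z) to itself. *)
Definition l2_bounded_matrix (A : int -> int -> R[i]) :=
  exists C : R, forall x : int -> R[i], (l2_sqnorm x < +oo)%E ->
    exists y : int -> R[i],
      (forall n : int,
         (fun N => normc (sym_sum (fun m => A n m * x m) N - y n)) @ \oo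
           --> (0 : R)) /\
      (l2_sqnorm y <= (C ^+ 2)%:E * l2_sqnorm x)%E.

End Sequences.

Section Fourier.
Context (R : realType).

Definition cexpi (x : R) : R[i] := cos x +i* sin x.

Definition fourier_coef (f : R -> R[i]) (n : int) : R[i] :=
  cintegral lebesgue_measure `[0, 1[
    (fun t => f t * cexpi (- (2 * pi * n%:~R * t))).

Definition L2_circle (f : R -> R[i]) :=
  periodic f 1 /\ L2 lebesgue_measure `[0, 1[ f.

End Fourier.

Section RandomSeries.
Context d (Omega : measurableType d) (R : realType) (P : probability Omega R).

Definition random_partial_sum (f : R -> R[i]) (xi : int -> Omega -> R[i])
    (t : R) (N : nat) (w : Omega) : R[i] :=
  sym_sum (fun n => fourier_coef f n * xi n w * cexpi (2 * pi * n%:~R * t)) N.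

Definition random_series_sum (f : R -> R[i]) (xi : int -> Omega -> R[i])
    (S : R -> Omega -> R[i]) :=
  circle_process S /\
  forall t, L2_cvg P (random_partial_sum f xi t) (S t).

End RandomSeries.

Section Hypotheses.
Context (R : realType).

Definition weighted_gamma (gamma : int -> R[i]) (b : R) (n m : int) : R[i] :=
  if (n == 0) || (m == 0) then 0
  else (normc (gamma (n - m)) * `|n * m|%:~R `^ (- b))%:C.

Definition weighted_tail (f : R -> R[i]) (b : R) (n : int) : \bar R :=
  \esum_(k in [set k : int | `|n| <= `|k|])
    (normc (fourier_coef f k) ^+ 2 * `|k|%:~R `^ (2 * b))%:E.

End Hypotheses.

(* Main.v *)
Require Import Defs.
From mathcomp Require Import all_boot all_order all_algebra.
From mathcomp Require Import all_classical all_reals all_analysis.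
From mathcomp.real_closed Require Import complex.
From mathcomp Require Import measurable_realfun ring lra zify.

Set Implicit Arguments.
Unset Strict Implicit.
Unset Printing Implicit Defensive.

Import Order.TTheory GRing.Theory Num.Theory.
Import numFieldNormedType.Exports.

Local Open Scope classical_set_scope.
Local Open Scope ring_scope.

(** The circle carries no more than about [2 ^ (2 ^ j)] independent directions
    at frequencies of size [2 ^ (2 ^ j)], so the maximum of a Gaussian
    trigonometric polynomial with such frequencies is at most of order
    [sqrt (ln (2 ^ (2 ^ j)))], that is [sqrt 2 ^+ j], times its standard
    deviation.  Cutting the series into the blocks
    [dyadic j < |n| <= dyadic j.+1], with [dyadic j = 2 ^ (2 ^ j)], it is thus
    enough to sum these products.

    - The covariance assumption enters once.  The second moment of a block is
      at most the double sum of [|a n| |a m| |gamma (n - m)|], and testing the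
      bounded matrix on the finitely supported vector [|a n| |n| ^ b] bounds it
      by the sum of [|a n|^2 |n| ^ (2 b)] over the block
      ([weighted_gamma_form], [second_moment_le], [block_second_moment]).  The
      standard deviation of block [j] is therefore at most [K * T (dyadic j)],
      where [T n] is the square root of the weighted tail at [n].

    - The hypothesis on [f] is exactly the summability of
      [sqrt 2 ^+ j * T (dyadic j)]: two successive Cauchy condensations turn
      the weight [1 / (n sqrt (ln n))] into [sqrt 2 ^+ j]
      ([double_condensation], [tail_blocks]).

    - The maximal inequality is elementary.  A centred Gaussian variable has
      exponential moments controlled by its variance ([gaussian_exp_moment]);
      on a grid of [N ^ 2] points, [N] being the largest frequency, a union
      bound on exponentials costs only a constant factor in the logarithm, and
      the grid is so fine that the trivial Lipschitz estimate controls the path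
      between two points ([trig_poly_grid], [trig_poly_sup_mean]).  Hence block
      [j] is bounded, uniformly in time, by a variable [V j], and the means of
      the [V j] are summable ([dyadic_blocks]).

    - Almost surely [V] is then summable, and the partial sums over
      [|n| <= dyadic j] converge uniformly.  Their limit has bounded continuous
      paths, so it is separable ([uniform_limit_process]).  By Fatou's lemma it
      is also the limit in [L2] of the full sequence of partial sums, because
      the second moment bound applies to every block [M < |n| <= N]
      ([L2_dist_limit_le]). *)

(** * Moments of Gaussian variables *)

Section GaussianMoments.
Context {R : realType}.
Local Notation mu := (@lebesgue_measure R).

(** The density of [normal_prob] is its Radon-Nikodym derivative, up to a null
    set. *)
Lemma ge0_integral_normal_prob (m s : R) (f : R -> \bar R) :
  measurable_fun setT f -> (forall x, (0 <= f x)%E) ->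
  (\int[normal_prob m s]_x f x = \int[mu]_x (f x * (normal_pdf m s x)%:E))%E.
Proof.
move=> mf f0.
rewrite -(Radon_Nikodym_SigmaFinite.change_of_variables
  (normal_prob_dominates m s))//.
have ifr := Radon_Nikodym_SigmaFinite.f_integrable (normal_prob_dominates m s).
apply: ae_eq_integral => //.
- by apply: emeasurable_funM => //; exact: (measurable_int mu).
- apply: emeasurable_funM => //; apply/measurable_EFinP.
  exact: measurable_normal_pdf.
- apply: ae_eqe_mul2l => /=.
  apply: integral_ae_eq => //=.
  + by apply/measurable_EFinP; exact: measurable_normal_pdf.
  + move=> E _ mE.
    by rewrite -Radon_Nikodym_SigmaFinite.f_integral//; exact: normal_prob_dominates.
Qed.

(** Completing the square: [expR (l * x)] times the density at [m] is a multiple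
    of the density translated by [l * s ^+ 2]. *)
Lemma normal_prob_mgf (m s l : R) : s != 0 ->
  (\int[normal_prob m s]_x (expR (l * x))%:E =
   (expR (l * m + l ^+ 2 * s ^+ 2 / 2))%:E)%E.
Proof.
move=> s0; rewrite ge0_integral_normal_prob; last 2 first.
  - by apply/measurable_EFinP; apply: measurableT_comp => //; exact: measurable_funM.
  - by move=> x; rewrite lee_fin expR_ge0.
have E x : ((expR (l * x))%:E * (normal_pdf m s x)%:E =
    (expR (l * m + l ^+ 2 * s ^+ 2 / 2))%:E *
    (normal_pdf (m + l * s ^+ 2) s x)%:E)%E.
  rewrite -!EFinM; congr EFin; rewrite !normal_pdfE// /normal_fun.
  rewrite mulrCA [RHS]mulrCA -!expRD; congr (_ * expR _).
  rewrite -mulr_natr; field.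
  by rewrite s0.
under eq_integral do rewrite E.
rewrite ge0_integralZl_EFin ?expR_ge0//.
- by rewrite integral_normal_pdf mule1.
- by move=> x _; rewrite lee_fin normal_pdf_ge0.
- by apply/measurable_EFinP; exact: measurable_normal_pdf.
Qed.

End GaussianMoments.

Section GaussianVariables.
Context d (Omega : measurableType d) (R : realType) (P : probability Omega R).

Definition gaussian_law (X : Omega -> R) (m s : R) :=
  forall A : set R, measurable A ->
    P (X @^-1` A) = if s == 0 then \d_m A else normal_prob m s A.

Lemma gaussian_integral (X : Omega -> R) (m s : R) (h : R -> \bar R) :
  measurable_fun setT X -> gaussian_law X m s ->
  measurable_fun setT h -> (forall x, (0 <= h x)%E) ->
  (\int[P]_w h (X w) =
    if (s == 0)%R then h m else \int[normal_prob m s]_x h x)%E.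
Proof.
move=> mX lawX mh h0.
(* normal_prob is a measure on measurableTypeR R, the reals seen as generated
   by intervals, and X has to be read as a variable with values there *)
have mX' : @measurable_fun _ _ Omega (measurableTypeR R) setT X by exact: mX.
pose X' : {mfun Omega >-> measurableTypeR R} :=
  @mfun_Sub _ _ Omega (measurableTypeR R) X (mem_set mX').
have mh' : @measurable_fun _ _ (measurableTypeR R) _ setT h by exact: mh.
have -> : (\int[P]_w h (X w) = \int[distribution P X']_x h x)%E.
  by rewrite ge0_integral_distribution.
have [s0|s0] := eqVneq s 0.
  rewrite (eq_measure_integral (@dirac _ (measurableTypeR R) m R)); last first.
    by move=> A mA _; rewrite [LHS](lawX A mA) s0 eqxx.
  by rewrite integral_dirac// diracT mul1e.
apply: eq_measure_integral => A mA _.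
by rewrite [LHS](lawX A mA) (negbTE s0).
Qed.

Lemma gaussian_mgf (X : Omega -> R) (m s : R) :
  measurable_fun setT X -> gaussian_law X m s ->
  forall l : R, (\int[P]_w (expR (l * X w))%:E =
    (expR (l * m + l ^+ 2 * s ^+ 2 / 2))%:E)%E.
Proof.
move=> mX lawX l.
rewrite (gaussian_integral (h := fun x => (expR (l * x))%:E) mX lawX); last 2 first.
- by apply/measurable_EFinP; apply: measurableT_comp => //; exact: measurable_funM.
- by move=> x; rewrite lee_fin expR_ge0.
have [->|s0] := eqVneq s 0; last exact: normal_prob_mgf.
by rewrite expr0n/= mulr0 mul0r addr0.
Qed.

(** Since [1 + x <= expR x], the affine lower bound on the moment generating
    function of a centred variable forces [l * m + l^2 s^2 / 2 >= 0] for all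
    [l], hence [m = 0]. *)
Lemma gaussian_mean0 (X : Omega -> R) (m s : R) :
  measurable_fun setT X -> gaussian_law X m s ->
  P.-integrable setT (EFin \o X) -> (\int[P]_w (X w)%:E = 0)%E ->
  m = 0.
Proof.
move=> mX lawX iX X0.
have iexp l : P.-integrable setT (fun w => (expR (l * X w))%:E).
  apply/integrableP; split.
    apply/measurable_EFinP; apply: measurableT_comp => //.
    exact: measurable_funM.
  under eq_integral do rewrite /= ger0_norm ?expR_ge0//.
  by rewrite (gaussian_mgf mX lawX) ltry.
have ge0 l : 0 <= l * m + l ^+ 2 * s ^+ 2 / 2.
  rewrite -ler_expR expR0 -lee_fin -(gaussian_mgf mX lawX).
  have -> : 1%:E = (\int[P]_w (1%:E + l%:E * (X w)%:E))%E.
    rewrite integralD//.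
    - rewrite integral_cst//= probability_setT mule1.
      by rewrite integralZl// X0 mule0 adde0.
    - exact: finite_measure_integrable_cst.
    - exact: integrableZl.
  apply: le_integral => //.
  - apply: integrableD => //; last exact: integrableZl.
    exact: finite_measure_integrable_cst.
  - by move=> w _; rewrite -EFinM -EFinD lee_fin expR_ge1Dx.
apply/eqP/negPn/negP => m0.
(* minimum of the quadratic, with s^2 + 1 in place of s^2 to avoid s = 0 *)
have := ge0 (- (m / (s ^+ 2 + 1))).
have s1 : 0 < s ^+ 2 + 1 by rewrite ltr_wpDl ?sqr_ge0.
have -> : - (m / (s ^+ 2 + 1)) * m + (- (m / (s ^+ 2 + 1))) ^+ 2 * s ^+ 2 / 2 =
   - (m ^+ 2 * (s ^+ 2 + 2) / (2 * (s ^+ 2 + 1) ^+ 2)).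
  by field; rewrite gt_eqF.
rewrite oppr_ge0 leNgt divr_gt0//.
  by rewrite mulr_gt0// ?exprn_even_gt0// ltr_wpDl ?sqr_ge0.
by rewrite mulr_gt0// exprn_gt0.
Qed.

(** Chebyshev's inequality puts mass at least 3/4 on [-2 sg, 2 sg], while the
    density is at most [normal_peak s], of order [1 / |s|]. *)
Lemma gaussian_scale_le (X : Omega -> R) (m s sg : R) :
  measurable_fun setT X -> gaussian_law X m s ->
  0 < sg -> (\int[P]_w ((X w) ^+ 2)%:E <= (sg ^+ 2)%:E)%E ->
  s ^+ 2 <= 16 * sg ^+ 2.
Proof.
move=> mX lawX sg0 X2.
have [->|s0] := eqVneq s 0; first by rewrite expr0n/= mulr_ge0// sqr_ge0.
pose A : set R := [set` `]- (2 * sg), (2 * sg)[].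
have mA : measurable A by exact: measurable_itv.
have PA : (P (X @^-1` A) <= (4 * sg * normal_peak s)%:E)%E.
  rewrite lawX// (negbTE s0) /normal_prob.
  apply: (@le_trans _ _ (\int[lebesgue_measure]_(x in A) (normal_peak s)%:E)%E).
    apply: ge0_le_integral => //.
    - by move=> x _; rewrite lee_fin normal_pdf_ge0.
    - by apply/measurable_EFinP/measurable_funTS; exact: measurable_normal_pdf.
    - by move=> x _; rewrite lee_fin normal_pdf_ub.
  rewrite integral_cst//= /A lebesgue_measure_itv/= lte_fin.
  rewrite ifT; last by rewrite gtrN ?mulr_gt0.
  by rewrite -EFinD -EFinM lee_fin mulrC le_eqVlt; apply/orP; left; apply/eqP; ring.
have mXA : measurable (X @^-1` A) by rewrite -(setTI (_ @^-1` _)); exact: mX.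
have PAC : ((4 * sg ^+ 2)%:E * P (~` (X @^-1` A)) <= (sg ^+ 2)%:E)%E.
  apply: le_trans X2.
  rewrite -(setIT (~` _)) -integral_indic//; last exact: measurableC.
  rewrite -ge0_integralZl_EFin//; last 2 first.
  - by apply/measurable_EFinP/measurable_indic/measurableC.
  - by rewrite mulr_ge0// sqr_ge0.
  under eq_integral do rewrite -EFinM.
  apply: ge0_le_integral => //.
  - by move=> w _; rewrite lee_fin indicE mulr_ge0 ?ler0n// mulr_ge0 ?sqr_ge0.
  - apply/measurable_EFinP/measurable_funM => //.
    exact/measurable_indic/measurableC.
  - by apply/measurable_EFinP; exact: measurable_funX.
  - move=> w _; rewrite lee_fin indicE.
    case: (boolP (w \in _)) => [|_]; last by rewrite mulr0 sqr_ge0.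
    rewrite inE /A /= in_itv/= => /negP; rewrite -ltr_norml -leNgt => h.
    rewrite mulr1 -(real_normK (num_real (X w))).
    have -> : 4 * sg ^+ 2 = (2 * sg) ^+ 2 by ring.
    by rewrite lerXn2r// nnegrE// mulr_ge0// ltW.
have := probability_setC P mXA.
have fP : P (X @^-1` A) \is a fin_num by exact: fin_num_measure.
rewrite -(fineK fP) in PA *; move: (fine _) PA => p PA pC.
move: PAC; rewrite pC -EFinB -EFinM !lee_fin => PAC.
(* Chebyshev gives P (|X| >= 2 sg) <= 1/4 *)
have p34 : 3 / 4 <= p.
  have : 4 * (1 - p) <= 1.
    rewrite -(@ler_pM2r _ (sg ^+ 2)) ?exprn_gt0// mul1r.
    by rewrite mulrAC.
  lra.
move: PA; rewrite lee_fin => /(le_trans p34).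
rewrite /normal_peak => h.
set q := Num.sqrt _ in h.
have q0 : 0 < q.
  by rewrite sqrtr_gt0 mulrn_wgt0// mulr_gt0 ?pi_gt0// exprn_even_gt0.
have q2 : q ^+ 2 = 2 * pi * s ^+ 2.
  rewrite sqr_sqrtr; first by rewrite -mulr_natr; ring.
  by rewrite mulrn_wge0// mulr_ge0 ?pi_ge0 ?sqr_ge0.
have qle : q <= 16 / 3 * sg by move: h; rewrite ler_pdivlMr//; lra.
have : q ^+ 2 <= (16 / 3 * sg) ^+ 2.
  by rewrite lerXn2r// nnegrE ?(ltW q0)// mulr_ge0// ltW.
rewrite q2 exprMn.
have := @pi_ge2 R; move: (@pi R) => pi' hpi.
have := sqr_ge0 s; have := sqr_ge0 sg; move: (sg ^+ 2) (s ^+ 2) => u v u0 v0 h2.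
nra.
Qed.

(** The constant 8 is half of the 16 of [gaussian_scale_le], which bounds the
    parameter [s ^+ 2] of the law by the second moment; the sharp constant is
    1/2, but only the order of magnitude matters below. *)
Lemma gaussian_exp_moment (X : Omega -> R) (sg l : R) :
  gaussian P X -> 0 < sg ->
  (\int[P]_w (X w)%:E = 0)%E ->
  (\int[P]_w ((X w) ^+ 2)%:E <= (sg ^+ 2)%:E)%E ->
  (\int[P]_w (expR (l * X w))%:E <= (expR (8 * l ^+ 2 * sg ^+ 2))%:E)%E.
Proof.
move=> [mX [m [s lawX]]] sg0 X0 X2.
have iX : P.-integrable setT (EFin \o X).
  apply: (@le_integrable _ _ _ _ _ measurableT _
      (fun w => (1 + X w ^+ 2)%:E)).
  - exact/measurable_EFinP.
  - move=> w _; rewrite /= lee_fin [leRHS]ger0_norm ?addr_ge0 ?sqr_ge0//.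
    rewrite -(real_normK (num_real (X w))).
    by have := sqr_ge0 (`|X w| - 1); have := normr_ge0 (X w); nra.
  - apply: (eq_integrable _ (cst 1%:E \+ (fun w => (X w ^+ 2)%:E))%E) => //.
    apply: integrableD => //; first exact: finite_measure_integrable_cst.
    apply/integrableP; split.
      by apply/measurable_EFinP; exact: measurable_funX.
    under eq_integral do rewrite /= ger0_norm ?sqr_ge0//.
    exact: le_lt_trans X2 (ltry _).
have m0 := gaussian_mean0 mX lawX iX X0.
have s2 := gaussian_scale_le mX lawX sg0 X2.
rewrite (gaussian_mgf mX lawX) m0 mulr0 add0r lee_fin ler_expR.
have := sqr_ge0 l; move: (l ^+ 2) (s ^+ 2) (sg ^+ 2) s2 => a u v; nra.
Qed.

End GaussianVariables.

(** * Double condensation of the tail hypothesis *)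

Section Condensation.
Context {R : realType}.

Definition dyadic (j : nat) : nat := (2 ^ (2 ^ j))%N.

Lemma sum_seq_le_esum (T : choiceType) (I : set T) (a : T -> \bar R)
    (s : seq T) :
  uniq s -> (forall i, i \in s -> I i) ->
  (\sum_(i <- s) a i <= \esum_(i in I) a i)%E.
Proof.
move=> us sI; apply: esum_ge; exists [set` s]; last by rewrite fsbig_seq.
by split; [exact: finite_seq | move=> i /= /sI].
Qed.

(** The block ]2^(i-1), 2^i] has 2^(i-1) elements and [g] is at least
    [g (2^i)] on it. *)
Lemma cauchy_condensation (g : nat -> R) (B : R) :
  (forall n, 0 <= g n) ->
  (forall m n, (2 <= m)%N -> (m <= n)%N -> g n <= g m) ->
  (forall n, \sum_(2 <= i < n) g i <= B) ->
  forall k, \sum_(2 <= i < k) (2 ^ i)%:R * g (2 ^ i)%N <= 2 * B.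
Proof.
move=> g0 gd gB.
suff H k : \sum_(2 <= i < k.+2) (2 ^ i)%:R * g (2 ^ i)%N <=
    2 * \sum_(2 <= n < (2 ^ k.+1).+1) g n.
  have B0 : 0 <= B by have := gB 0%N; rewrite big_geq.
  move=> [|[|k]]; [by rewrite big_geq// mulr_ge0..|].
  by apply: (le_trans (H k)); rewrite ler_pM2l.
elim: k => [|k IH].
  by rewrite big_geq// mulr_ge0// sumr_ge0.
have k2 : (2 <= 2 ^ k.+1)%N by rewrite -{1}(expn1 2) leq_exp2l.
rewrite big_nat_recr//= [in leRHS](big_cat_nat (n := (2 ^ k.+1).+1))//=; last 2 first.
- by rewrite (leq_trans k2).
- by rewrite ltnS leq_exp2l.
have e2 : (2 ^ k.+2 = 2 * 2 ^ k.+1)%N by rewrite -expnS.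
rewrite mulrDr lerD// [X in X * g _ <= _](_ : _ = 2 * (2 ^ k.+1)%:R); last first.
  by rewrite e2 natrM.
rewrite -mulrA ler_pM2l//.
apply: (@le_trans _ _ (\sum_((2 ^ k.+1).+1 <= i < (2 ^ k.+2).+1)
    g (2 ^ k.+2)%N)).
  by rewrite big_const_nat iter_addr_0 subSS mulr_natl {3}e2 mul2n -addnn addnK.
rewrite ler_sum_nat// => i /andP[i1 i2]; apply: gd.
  by rewrite (leq_trans k2)// ltnW.
by rewrite -ltnS.
Qed.

Lemma ln2_le1 : ln 2 <= 1 :> R.
Proof. by have := @le_ln1Dx R 1; apply; lra. Qed.

Lemma sqrt2X (j : nat) : (Num.sqrt 2 ^+ j) ^+ 2 = (2 ^ j)%:R :> R.
Proof. by rewrite -exprM mulnC exprM sqr_sqrtr// natrX. Qed.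

(** Condensing twice turns the weight [1 / (n sqrt (ln n))] into the weight
    [sqrt 2 ^+ j] along [2 ^ (2 ^ j)]: each step multiplies by the length of
    the dyadic block. *)
Lemma double_condensation (T : nat -> R) (B : R) :
  (forall n, 0 <= T n) ->
  (forall m n, (2 <= m)%N -> (m <= n)%N -> T n <= T m) ->
  (forall n, \sum_(2 <= i < n) T i / (i%:R * Num.sqrt (ln i%:R)) <= B) ->
  forall k, \sum_(2 <= j < k) Num.sqrt 2 ^+ j * T (dyadic j) <= 4 * B.
Proof.
move=> T0 Td TB k.
pose g n := T n / (n%:R * Num.sqrt (ln n%:R)).
pose h i := (2 ^ i)%:R * g (2 ^ i)%N.
have g0 n : 0 <= g n by rewrite divr_ge0// mulr_ge0// sqrtr_ge0.
have h0 i : 0 <= h i by rewrite mulr_ge0.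
have lngt0 n : (2 <= n)%N -> 0 < ln n%:R :> R.
  by move=> n2; rewrite ln_gt0// ltr1n.
have gd m n : (2 <= m)%N -> (m <= n)%N -> g n <= g m.
  move=> m2 mn; have n2 := leq_trans m2 mn.
  have m0 : (0 < m)%N by exact: ltnW.
  have n0 : (0 < n)%N by exact: ltnW.
  rewrite ler_pM ?invr_ge0 ?mulr_ge0 ?sqrtr_ge0//; first exact: Td.
  rewrite lef_pV2 ?posrE ?mulr_gt0 ?ltr0n ?sqrtr_gt0 ?lngt0//.
  by rewrite ler_pM ?sqrtr_ge0 ?ler_nat// ler_wsqrtr// ler_ln ?posrE ?ltr0n// ler_nat.
have hE i : (0 < i)%N -> h i = T (2 ^ i)%N / Num.sqrt (i%:R * ln 2).
  move=> i0; rewrite /h /g natrX lnXn// mulr_natl.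
  by rewrite invfM mulrCA mulVKf// expf_neq0.
have hd m n : (2 <= m)%N -> (m <= n)%N -> h n <= h m.
  move=> m2 mn; have n2 := leq_trans m2 mn.
  have m0 : (0 < m)%N by exact: ltnW.
  have n0 : (0 < n)%N by exact: ltnW.
  rewrite !hE//.
  have l2 : 0 < ln 2 :> R by apply: (lngt0 2%N).
  rewrite ler_pM ?invr_ge0 ?sqrtr_ge0//.
    apply: Td; first by rewrite -{1}(expn1 2) leq_exp2l.
    by rewrite leq_exp2l.
  rewrite lef_pV2 ?posrE ?sqrtr_gt0 ?mulr_gt0 ?ltr0n//.
  by rewrite ler_wsqrtr// ler_pM2r// ler_nat.
have hB := cauchy_condensation g0 gd TB.
have -> : 4 * B = 2 * (2 * B) by ring.
apply: le_trans (cauchy_condensation h0 hd hB k).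
apply: ler_sum_nat => j _.
have l2 : 0 < ln 2 :> R by apply: (lngt0 2%N).
rewrite hE ?expn_gt0// sqrtrM// -sqrt2X sqrtr_sqr ger0_norm; last first.
  by rewrite exprn_ge0// sqrtr_ge0.
have r0 : 0 < Num.sqrt 2 ^+ j :> R by rewrite exprn_gt0// sqrtr_gt0.
rewrite invfM expr2 -!mulrA ler_pM2l// mulrCA mulVKf ?gt_eqF//.
rewrite -[leLHS]mulr1 ler_wpM2l// invf_ge1 ?sqrtr_gt0//.
by rewrite -[leRHS]sqrtr1 ler_wsqrtr// ln2_le1.
Qed.

End Condensation.

Section Tails.
Context {R : realType}.

(** The finite function [T n] is the square root of the tail of [c] from [n] on;
    the weight is positive for [n >= 2], so a convergent sum forces these tails
    to be finite. *)
Lemma tail_blocks (c : int -> R) :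
  (forall k, 0 <= c k) ->
  (\esum_(n in [set n : int | (2 <= `|n|)%R])
     (sqrte (\esum_(k in [set k : int | (`|n| <= `|k|)%R]) (c k)%:E) *
      ((`|n|%:~R * Num.sqrt (ln `|n|%:~R))^-1)%:E) < +oo)%E ->
  exists T : nat -> R,
    [/\ forall n, 0 <= T n,
        forall m n, (2 <= m)%N -> (m <= n)%N -> T n <= T m,
        forall n (s : seq int), (2 <= n)%N -> uniq s ->
          (forall k, k \in s -> (n <= `|k|)%N) ->
          \sum_(k <- s) c k <= T n ^+ 2 &
        exists B, forall k, \sum_(j < k) Num.sqrt 2 ^+ j * T (dyadic j) <= B].
Proof.
move=> c0; set E := esum _ _ => Efin.
pose tail (n : int) : \bar R := \esum_(k in [set k : int | `|n| <= `|k|]) (c k)%:E.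
pose g (n : int) := (sqrte (tail n) *
  ((`|n|%:~R * Num.sqrt (ln `|n|%:~R))^-1)%:E)%E.
have nZ (n : nat) : `|n%:Z| = n%:Z :> int by [].
have nR (n : nat) : `|n%:Z|%:~R = n%:R :> R by [].
have tail0 n : (0 <= tail n)%E by apply: esum_ge0 => k _; rewrite lee_fin.
have lngt0 n : (2 <= n)%N -> 0 < ln n%:R :> R.
  by move=> n2; rewrite ln_gt0// ltr1n.
have w0 (n : nat) : (2 <= n)%N -> 0 < (n%:R * Num.sqrt (ln n%:R))^-1 :> R.
  by move=> n2; rewrite invr_gt0 mulr_gt0 ?sqrtr_gt0 ?lngt0// ltr0n ltnW.
have g0 n : (0 <= g n)%E.
  by rewrite mule_ge0 ?sqrte_ge0// lee_fin invr_ge0 mulr_ge0// sqrtr_ge0.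
have E0 : (0 <= E)%E by apply: esum_ge0 => n _; exact: g0.
have finT (n : nat) : (2 <= n)%N -> sqrte (tail n) \is a fin_num.
  move=> n2; rewrite ge0_fin_numE ?sqrte_ge0// ltNge leye_eq.
  apply/negP => /eqP too.
  have : (g n <= E)%E.
    have := @sum_seq_le_esum R int [set n : int | (2 <= `|n|)%R] g [:: n%:Z].
    rewrite big_seq1; apply => // i; rewrite inE => /eqP ->/=.
    by rewrite nZ lez_nat.
  rewrite /g too gt0_mulye ?leye_eq; last by rewrite lte_fin nR w0.
  by move=> /eqP Ey; move: Efin; rewrite Ey.
have fin2 (n : nat) : (2 <= n)%N -> tail n \is a fin_num.
  by move=> /finT; rewrite sqrte_fin_num.
pose T n := fine (sqrte (tail n%:Z)).
have T0 n : 0 <= T n by rewrite fine_ge0// sqrte_ge0.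
have Td m n : (2 <= m)%N -> (m <= n)%N -> T n <= T m.
  move=> m2 mn; have n2 := leq_trans m2 mn.
  rewrite fine_le ?finT// lee_sqrt//.
  rewrite /tail esum_mkcond [leRHS]esum_mkcond; apply: le_esum => k _.
  case: ifPn => [|_]; last by case: ifPn; rewrite ?lee_fin.
  rewrite inE/= => nk; rewrite ifT// inE/=.
  by apply: le_trans nk; rewrite !nZ lez_nat.
exists T; split=> //.
  move=> n s n2 us sn.
  have : (\sum_(k <- s) (c k)%:E <= tail n)%E.
    by apply: sum_seq_le_esum => // k /sn nk /=.
  rewrite sumEFin -(fineK (fin2 _ n2)) lee_fin => /le_trans; apply.
  rewrite /T; have := fin2 _ n2; have := tail0 n%:Z; case: (tail n) => //= r r0 _.
  by rewrite sqr_sqrtr.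
have TB n : \sum_(2 <= i < n) T i / (i%:R * Num.sqrt (ln i%:R)) <= fine E.
  rewrite -lee_fin fineK; last by rewrite ge0_fin_numE.
  rewrite -sumEFin.
  have H : (\sum_(2 <= i < n) g i%:Z <= E)%E.
    rewrite -(big_map (fun i => i%:Z) xpredT g); apply: sum_seq_le_esum.
      by rewrite map_inj_uniq ?iota_uniq// => ? ? [].
    move=> i /mapP[k]; rewrite mem_index_iota => /andP[k2 _] ->/=.
    by rewrite nZ lez_nat.
  apply: le_trans H; rewrite big_nat [leRHS]big_nat.
  apply: lee_sum => i /andP[i2 _].
  by rewrite /g EFinM nR fineK// finT.
(* the condensed sum starts at 2: the terms of index 0 and 1 are added *)
have D := double_condensation T0 Td TB.
pose u j := Num.sqrt 2 ^+ j * T (dyadic j).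
have u0 j : 0 <= u j by rewrite mulr_ge0 ?exprn_ge0 ?sqrtr_ge0.
exists (4 * fine E + (u 0%N + u 1%N)) => k.
rewrite -(big_mkord xpredT u).
apply: (@le_trans _ _ (\sum_(0 <= j < k.+2) u j)).
  rewrite (big_cat_nat (n := k) (p := k.+2))//=; last exact: leqW.
  by rewrite lerDl sumr_ge0.
rewrite big_ltn// big_ltn// addrA addrC lerD2r.
exact: D.
Qed.

End Tails.

(** * Complex modulus and symmetric ranges of frequencies *)

Section ComplexModulus.
Context {R : realType}.
Implicit Types z : R[i].

Lemma complex_ReD z1 z2 : complex.Re (z1 + z2) = complex.Re z1 + complex.Re z2.
Proof. by case: z1; case: z2. Qed.

Lemma complex_ImD z1 z2 : complex.Im (z1 + z2) = complex.Im z1 + complex.Im z2.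
Proof. by case: z1; case: z2. Qed.

Lemma complex_ReN z : complex.Re (- z) = - complex.Re z.
Proof. by case: z. Qed.

Lemma complex_ImN z : complex.Im (- z) = - complex.Im z.
Proof. by case: z. Qed.

Lemma complex_ReM z1 z2 : complex.Re (z1 * z2) =
  complex.Re z1 * complex.Re z2 - complex.Im z1 * complex.Im z2.
Proof. by case: z1; case: z2. Qed.

Lemma complex_ImM z1 z2 : complex.Im (z1 * z2) =
  complex.Re z1 * complex.Im z2 + complex.Im z1 * complex.Re z2.
Proof. by case: z1; case: z2. Qed.

Lemma complex_Re_sum I (s : seq I) (F : I -> R[i]) :
  complex.Re (\sum_(i <- s) F i) = \sum_(i <- s) complex.Re (F i).
Proof. by elim/big_rec2: _ => // i x y _ <-; rewrite complex_ReD. Qed.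

Lemma normc_sqr z : normc z ^+ 2 = complex.Re z ^+ 2 + complex.Im z ^+ 2.
Proof. by case: z => a b /=; rewrite sqr_sqrtr// addr_ge0// sqr_ge0. Qed.

Lemma normc_ge0 z : 0 <= normc z.
Proof. by case: z => a b /=; exact: sqrtr_ge0. Qed.

Lemma normc_sum I (s : seq I) (F : I -> R[i]) :
  normc (\sum_(i <- s) F i) <= \sum_(i <- s) normc (F i).
Proof.
elim/big_ind2 : _ => //; first by rewrite /= expr0n/= addr0 sqrtr0.
by move=> x1 x2 y1 y2 h1 h2; apply: le_trans (le_normcD _ _) _; exact: lerD.
Qed.

Lemma normc_conjc z : normc (conjc z) = normc z.
Proof. by case: z => a b /=; rewrite sqrrN. Qed.

Lemma normc_real (x : R) : normc (real_complex R x) = `|x|.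
Proof. by rewrite /= expr0n/= addr0 sqrtr_sqr. Qed.

Lemma normr_Re_le z : `|complex.Re z| <= normc z.
Proof.
rewrite -(ger0_norm (normc_ge0 z)) -ler_sqr ?nnegrE// !real_normK ?num_real//.
by rewrite normc_sqr lerDl sqr_ge0.
Qed.

Lemma normr_Im_le z : `|complex.Im z| <= normc z.
Proof.
rewrite -(ger0_norm (normc_ge0 z)) -ler_sqr ?nnegrE// !real_normK ?num_real//.
by rewrite normc_sqr lerDr sqr_ge0.
Qed.

Lemma normc_le_Re_Im z : normc z <= `|complex.Re z| + `|complex.Im z|.
Proof.
rewrite -(ger0_norm (normc_ge0 z)).
rewrite -(ger0_norm (addr_ge0 (normr_ge0 (complex.Re z)) (normr_ge0 (complex.Im z)))).
rewrite -ler_sqr ?nnegrE// !real_normK ?num_real//.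
rewrite normc_sqr -(real_normK (num_real (complex.Re z))).
rewrite -(real_normK (num_real (complex.Im z))).
have := normr_ge0 (complex.Re z); have := normr_ge0 (complex.Im z).
by move: `|_| `|_| => u v; nra.
Qed.

Lemma normc_sqr_Re z : normc z ^+ 2 = complex.Re (z * conjc z).
Proof. by rewrite normc_sqr; case: z => a b /=; ring. Qed.

End ComplexModulus.

Section SymmetricRanges.

Definition sym_range (N : nat) : seq int :=
  [seq k%:Z - N%:Z | k <- iota 0 N.*2.+1].

Definition sym_block (M N : nat) : seq int :=
  [seq n <- sym_range N | (M < `|n|)%N].

Lemma sym_sumE (V : zmodType) (u : int -> V) N :
  sym_sum u N = \sum_(n <- sym_range N) u n.
Proof.
rewrite /sym_sum /sym_range big_map.
by rewrite -(big_mkord xpredT (fun k => u (k%:Z - N%:Z))) /index_iota subn0.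
Qed.

Lemma sym_range_uniq N : uniq (sym_range N).
Proof.
by rewrite map_inj_uniq ?iota_uniq// => i j /(congr1 (+%R^~ N%:Z)); rewrite !subrK => -[].
Qed.

Lemma mem_sym_range N n : (n \in sym_range N) = (`|n| <= N)%N.
Proof.
apply/mapP/idP => [[k]|nN].
  by rewrite mem_iota /= => kN ->; lia.
exists (absz (n + N%:Z)%R); first by rewrite mem_iota/=; lia.
lia.
Qed.

Lemma sym_block_uniq M N : uniq (sym_block M N).
Proof. by rewrite filter_uniq// sym_range_uniq. Qed.

Lemma mem_sym_block M N n : (n \in sym_block M N) = (M < `|n| <= N)%N.
Proof. by rewrite mem_filter mem_sym_range. Qed.

Lemma sym_sumB (V : zmodType) (u : int -> V) M N : (M <= N)%N ->
  sym_sum u N - sym_sum u M = \sum_(n <- sym_block M N) u n.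
Proof.
move=> MN; rewrite !sym_sumE (bigID (fun n : int => M < `|n|)%N)/=.
suff -> : \sum_(n <- sym_range M) u n =
    \sum_(n <- sym_range N | ~~ (M < `|n|)%N) u n by rewrite addrK big_filter.
rewrite -[RHS]big_filter; apply: perm_big.
apply: uniq_perm; rewrite ?filter_uniq ?sym_range_uniq// => n.
by rewrite mem_filter !mem_sym_range -leqNgt; lia.
Qed.

Lemma size_sym_range N : size (sym_range N) = N.*2.+1.
Proof. by rewrite size_map size_iota. Qed.

End SymmetricRanges.

(** * Second moment of a random trigonometric polynomial *)

Section BoundedMatrix.
Context {R : realType}.

(** Testing the operator against a finitely supported nonnegative vector; the
    weight [|n m|^-b] of the matrix is absorbed in the vector [c n |n|^b]. *)
Lemma weighted_gamma_form (gamma : int -> R[i]) (b : R) :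
  l2_bounded_matrix (weighted_gamma gamma b) ->
  exists2 K : R, 0 < K & forall (s : seq int) (c : int -> R),
    uniq s -> (forall n, n \in s -> n != 0) -> (forall n, 0 <= c n) ->
    \sum_(n <- s) \sum_(m <- s) c n * c m * normc (gamma (n - m)) <=
    K * \sum_(n <- s) c n ^+ 2 * `|n|%:~R `^ (2 * b).
Proof.
move=> [C bC]; exists (`|C| + 1); first by rewrite ltr_wpDl.
move=> s c us s0 c0; set K := `|C| + 1.
have K0 : 0 < K by rewrite ltr_wpDl.
pose w (n : int) : R := `|n|%:~R `^ b.
have w0 n : n != 0 -> 0 < w n.
  by move=> n0; rewrite powR_gt0// ltr0z normr_gt0.
pose v n := if n \in s then c n * w n else 0.
pose x n := real_complex R (v n).
have v0 n : 0 <= v n.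
  by rewrite /v; case: ifP => // ns; rewrite mulr_ge0 ?powR_ge0.
have x2 n : normc (x n) ^+ 2 = v n ^+ 2 by rewrite normc_real ger0_norm.
have supp (a : int -> R) : (forall n, n \notin s -> a n = 0) ->
    (forall n, 0 <= a n) ->
    (\esum_(n in [set: int]) (a n)%:E = (\sum_(n <- s) a n)%:E)%E.
  move=> as0 a0; rewrite -sumEFin (fsbig_seq _ _ us) -esum_fset//; last first.
    by move=> n _; rewrite lee_fin.
  rewrite [RHS]esum_mkcond; apply: eq_esum => n _.
  case: ifPn => // /negP ns; rewrite as0//; apply/negP => ns'.
  by apply: ns; rewrite inE.
have l2x : l2_sqnorm x = (\sum_(n <- s) v n ^+ 2)%:E.
  rewrite /l2_sqnorm (eq_esum (b := fun n => (v n ^+ 2)%:E)); last first.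
    by move=> n _; rewrite x2.
  apply: supp => n; last exact: sqr_ge0.
  by rewrite /v => /negbTE ->; rewrite expr0n.
have [|y [ylim ybd]] := bC x; first by rewrite l2x ltry.
pose r n := \sum_(m <- s) normc (gamma (n - m)) * `|n * m|%:~R `^ (- b) * v m.
have r0 n : 0 <= r n.
  by rewrite sumr_ge0// => m _; rewrite !mulr_ge0 ?powR_ge0 ?normc_ge0.
have yE n : n \in s -> normc (y n) = r n.
  move=> ns; pose M := \max_(m <- s) absz m.
  have rE N : (M <= N)%N ->
      sym_sum (fun m => weighted_gamma gamma b n m * x m) N = real_complex R (r n).
    move=> MN; rewrite sym_sumE /r rmorph_sum/=.
    have -> : \sum_(m <- s) real_complex R (normc (gamma (n - m)) *
          `|n * m|%:~R `^ (- b) * v m) =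
        \sum_(m <- s) weighted_gamma gamma b n m * x m.
      rewrite [LHS]big_seq [RHS]big_seq; apply: eq_bigr => m ms.
      rewrite /weighted_gamma ifF; first by rewrite -rmorphM.
      by apply/negP => /orP[/eqP h|/eqP h]; [move: (s0 _ ns)|move: (s0 _ ms)];
        rewrite h eqxx.
    rewrite (bigID (mem s))/= [X in _ + X]big1 ?addr0; last first.
      by move=> m /negbTE ms; rewrite /x /v ms mulr0.
    rewrite -big_filter; apply: perm_big; apply: uniq_perm => //.
      by rewrite filter_uniq// sym_range_uniq.
    move=> m; rewrite mem_filter mem_sym_range.
    case: (boolP (m \in s)) => //= ms; apply: leq_trans MN.
    exact: (leq_bigmax_seq (F := absz)).
  (* the row sums are constant once N exceeds the support of x *)
  have Hlim : (fun N => normc (sym_sum (fun m => weighted_gamma gamma b n m * x m) N - y n))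
      @ \oo --> normc (real_complex R (r n) - y n).
    apply: cvg_near_cst; exists M => // N /= MN.
    by rewrite rE.
  have e : normc (real_complex R (r n) - y n) = 0.
    exact: (cvg_unique _ Hlim (ylim n)).
  move/ComplexField.Normc.eq0_normc/eqP : e; rewrite subr_eq0 => /eqP <-.
  by rewrite normc_real ger0_norm.
have y2 : \sum_(n <- s) r n ^+ 2 <= K ^+ 2 * \sum_(n <- s) v n ^+ 2.
  rewrite -lee_fin -sumEFin.
  apply: (@le_trans _ _ (l2_sqnorm y)).
    apply: (le_trans _ (@sum_seq_le_esum R int setT _ s us (fun _ _ => Logic.I))).
    rewrite big_seq [leRHS]big_seq; apply: lee_sum => n ns.
    by rewrite yE.
  apply: (le_trans ybd); rewrite l2x -EFinM lee_fin ler_wpM2r ?sumr_ge0//.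
    by move=> n _; exact: sqr_ge0.
  rewrite -(real_normK (num_real C)) lerXn2r ?nnegrE//; first exact: ltW.
  by rewrite /K lerDl.
apply: (@le_trans _ _ (\sum_(n <- s) v n * r n)).
  rewrite [leLHS]big_seq [leRHS]big_seq; apply: ler_sum => n ns.
  rewrite /r mulr_sumr [leLHS]big_seq [leRHS]big_seq; apply: ler_sum => m ms.
  rewrite /v ns ms normrM intrM powRM ?ler0z// !powRN -/(w n) -/(w m).
  rewrite le_eqVlt; apply/orP; left; apply/eqP; field.
  by rewrite !gt_eqF ?w0 ?s0.
(* Cauchy-Schwarz in the form 2 v r <= K v^2 + r^2 / K *)
apply: (@le_trans _ _ (\sum_(n <- s) (K * v n ^+ 2 + K^-1 * r n ^+ 2) / 2)).
  apply: ler_sum => n _; rewrite ler_pdivlMr// -subr_ge0.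
  have -> : K * v n ^+ 2 + K^-1 * r n ^+ 2 - v n * r n * 2 =
      K^-1 * (K * v n - r n) ^+ 2 by field; rewrite gt_eqF.
  by rewrite mulr_ge0 ?sqr_ge0// invr_ge0 ltW.
have -> : \sum_(n <- s) c n ^+ 2 * `|n|%:~R `^ (2 * b) = \sum_(n <- s) v n ^+ 2.
  rewrite [LHS]big_seq [RHS]big_seq; apply: eq_bigr => n ns.
  rewrite /v ns exprMn /w; congr (_ * _).
  by rewrite -[RHS]powR_mulrn ?powR_ge0// -powRrM mulrC.
rewrite -mulr_suml big_split/= -!mulr_sumr ler_pdivrMr//.
have : K^-1 * \sum_(n <- s) r n ^+ 2 <= K * \sum_(n <- s) v n ^+ 2.
  by rewrite ler_pdivrMl// mulrA -expr2.
lra.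
Qed.

End BoundedMatrix.

Section SecondMoment.
Context d (Omega : measurableType d) (R : realType) (P : probability Omega R).

Lemma measurable_normc_sqr (X : Omega -> R[i]) : cmeasurable setT X ->
  measurable_fun setT (fun w => (normc (X w) ^+ 2)%:E).
Proof.
move=> [mR mI]; apply/measurable_EFinP; under eq_fun do rewrite normc_sqr.
by apply: measurable_funD; exact: measurable_funX.
Qed.

Lemma L2_integrable_mulJ (X Y : Omega -> R[i]) :
  L2 P setT X -> L2 P setT Y ->
  P.-integrable setT (fun w => (complex.Re (X w * conjc (Y w)))%:E) /\
  P.-integrable setT (fun w => (complex.Im (X w * conjc (Y w)))%:E).
Proof.
move=> [[mX1 mX2] X2] [[mY1 mY2] Y2].
have isq (Z : Omega -> R[i]) : cmeasurable setT Z ->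
    (\int[P]_w (normc (Z w) ^+ 2)%:E < +oo)%E ->
    P.-integrable setT (fun w => (normc (Z w) ^+ 2)%:E).
  move=> mZ Z2; apply/integrableP; split; first exact: measurable_normc_sqr.
  by under eq_integral do rewrite /= ger0_norm ?sqr_ge0//.
have iXY : P.-integrable setT (fun w => (normc (X w) ^+ 2 + normc (Y w) ^+ 2)%:E).
  apply: (eq_integrable _
    ((fun w => (normc (X w) ^+ 2)%:E) \+ (fun w => (normc (Y w) ^+ 2)%:E))%E) => //.
  by apply: integrableD => //; apply: isq.
have bd w : normc (X w * conjc (Y w)) <= normc (X w) ^+ 2 + normc (Y w) ^+ 2.
  rewrite ComplexField.Normc.normcM normc_conjc.
  have := normc_ge0 (X w); have := normc_ge0 (Y w).
  by move: (normc _) (normc _) => u v; nra.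
have ReJ z : complex.Re (conjc z) = complex.Re z :> R by case: z.
have ImJ z : complex.Im (conjc z) = - complex.Im z :> R by case: z.
split; apply: le_integrable iXY => //.
- apply/measurable_EFinP; under eq_fun do rewrite complex_ReM ReJ ImJ.
  apply: measurable_funB; apply: measurable_funM => //.
  exact: measurableT_comp.
- move=> w _; rewrite /= lee_fin [leRHS]ger0_norm ?addr_ge0 ?sqr_ge0//.
  by apply: le_trans (bd w); exact: normr_Re_le.
- apply/measurable_EFinP; under eq_fun do rewrite complex_ImM ReJ ImJ.
  apply: measurable_funD; apply: measurable_funM => //.
  exact: measurableT_comp.
- move=> w _; rewrite /= lee_fin [leRHS]ger0_norm ?addr_ge0 ?sqr_ge0//.
  by apply: le_trans (bd w); exact: normr_Im_le.
Qed.

(** Expanding the square, the mean of each cross term is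
    [Re (c n * conjc (c m) * gamma (n - m))]. *)
Lemma second_moment_le (xi : int -> Omega -> R[i]) (gamma : int -> R[i])
    (s : seq int) (c : int -> R[i]) :
  (forall n, L2 P setT (xi n)) ->
  (forall n m : int,
    cexpectation P (fun w => xi n w * conjc (xi m w)) = gamma (n - m)) ->
  (\int[P]_w (normc (\sum_(n <- s) c n * xi n w) ^+ 2)%:E <=
   (\sum_(n <- s) \sum_(m <- s)
      normc (c n) * normc (c m) * normc (gamma (n - m)))%:E)%E.
Proof.
move=> xiL2 cov.
pose s2 := [seq (n, m) | n <- s, m <- s].
pose dd (p : int * int) := c p.1 * conjc (c p.2).
pose h (p : int * int) w := xi p.1 w * conjc (xi p.2 w).
pose F p w := complex.Re (dd p) * complex.Re (h p w) -
              complex.Im (dd p) * complex.Im (h p w).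
have iR p : P.-integrable setT (fun w => (complex.Re (h p w))%:E).
  by have [] := L2_integrable_mulJ (xiL2 p.1) (xiL2 p.2).
have iI p : P.-integrable setT (fun w => (complex.Im (h p w))%:E).
  by have [] := L2_integrable_mulJ (xiL2 p.1) (xiL2 p.2).
have iF p : P.-integrable setT (fun w => (F p w)%:E).
  apply: (eq_integrable _ ((fun w => ((complex.Re (dd p))%:E * (complex.Re (h p w))%:E)) \-
     (fun w => ((complex.Im (dd p))%:E * (complex.Im (h p w))%:E)))%E) => //.
  by apply: integrableB => //; exact: integrableZl.
have -> : (\int[P]_w (normc (\sum_(n <- s) c n * xi n w) ^+ 2)%:E =
    \int[P]_w (\sum_(p <- s2) (F p w)%:E))%E.
  apply: eq_integral => w _; rewrite sumEFin; congr EFin.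
  rewrite normc_sqr_Re rmorph_sum/= mulr_suml complex_Re_sum /s2 big_allpairs_dep/=.
  apply: eq_bigr => n _; rewrite mulr_sumr complex_Re_sum; apply: eq_bigr => m _.
  by rewrite /F -complex_ReM /dd /h/= rmorphM/= mulrACA.
rewrite integral_sum//.
have IF p : (\int[P]_w (F p w)%:E = (complex.Re (dd p * gamma (p.1 - p.2)))%:E)%E.
  under eq_integral do rewrite EFinB !EFinM.
  rewrite integralB//; [|exact: integrableZl..].
  rewrite !integralZl// -cov complex_ReM /cexpectation /cintegral/= /Rintegral.
  rewrite EFinB !EFinM (fineK (integrable_fin_num measurableT (iR p))).
  by rewrite (fineK (integrable_fin_num measurableT (iI p))).
under eq_bigr do rewrite IF.
rewrite sumEFin lee_fin /s2 big_allpairs_dep/=.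
apply: ler_sum => n _; apply: ler_sum => m _.
apply: le_trans (ler_norm _) _; apply: le_trans (normr_Re_le _) _.
by rewrite !ComplexField.Normc.normcM normc_conjc.
Qed.

End SecondMoment.

(** * Reduction of a supremum over the circle to a finite grid *)

Section TrigonometricPolynomials.
Context {R : realType}.
Implicit Types (a : int -> R[i]) (z : int -> R[i]) (s : seq int) (t : R).

Lemma normr_cosB (x y : R) : `|cos x - cos y| <= `|x - y|.
Proof.
wlog xy : x y / y <= x.
  move=> W; have [/W//|/ltW/W] := leP y x.
  by rewrite distrC (distrC x).
have [|c _ ->] := @MVT_segment R cos (fun c => - sin c) y x xy.
- by apply: continuous_subspaceT; exact: continuous_cos.
- by rewrite normrM normrN ler_piMl// ler_norml sin_geN1 sin_le1.
Qed.

Lemma normr_sinB (x y : R) : `|sin x - sin y| <= `|x - y|.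
Proof.
rewrite -!cosBpihalf (_ : x - y = (x - pi / 2) - (y - pi / 2)); last by ring.
exact: normr_cosB.
Qed.

Lemma cexpi_lipschitz (x y : R) : normc (cexpi x - cexpi y) <= 2 * `|x - y|.
Proof.
apply: le_trans (normc_le_Re_Im _) _; rewrite mulr_natl mulr2n /cexpi/=.
by apply: lerD; [exact: normr_cosB|exact: normr_sinB].
Qed.

Lemma normc_cexpi (x : R) : normc (cexpi x) = 1.
Proof. by rewrite /cexpi /= cos2Dsin2 sqrtr1. Qed.

Lemma cexpi_periodic (n : int) t (k : int) :
  cexpi (2 * pi * n%:~R * (t + k%:~R)) = cexpi (2 * pi * n%:~R * t).
Proof.
have cN (x : R) (m : nat) : cexpi (x + (pi *+ 2) *+ m) = cexpi x.
  by rewrite /cexpi (periodicn (@cosD2pi R)) (periodicn (@sinD2pi R)).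
have -> : 2 * pi * n%:~R * (t + k%:~R) =
    2 * pi * n%:~R * t + (pi *+ 2) * (n * k)%:~R :> R.
  by rewrite intrM -mulr_natl; ring.
case: (n * k) => m; first by rewrite -pmulrn mulr_natr cN.
rewrite NegzE mulrNz -pmulrn mulrN mulr_natr.
by rewrite -[LHS](cN _ m.+1) subrK.
Qed.

(** The coefficients are kept apart in a deterministic part [a] and a part [z]
    that will be the value of the Gaussian sequence at a point of the
    probability space. *)
Definition trig_poly a s z t : R[i] :=
  \sum_(n <- s) a n * z n * cexpi (2 * pi * n%:~R * t).

Lemma trig_poly_periodic a s z t (k : int) :
  trig_poly a s z (t + k%:~R) = trig_poly a s z t.
Proof. by apply: eq_bigr => n _; rewrite cexpi_periodic. Qed.

Lemma trig_poly_lipschitz a s z (N : nat) t t' :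
  (forall n, n \in s -> (`|n| <= N)%N) ->
  normc (trig_poly a s z t - trig_poly a s z t') <=
  4 * pi * N%:R * (\sum_(n <- s) normc (a n) * normc (z n)) * `|t - t'|.
Proof.
move=> sN; rewrite -sumrB; apply: le_trans (normc_sum _ _) _.
rewrite mulr_sumr mulr_suml [leLHS]big_seq [leRHS]big_seq.
apply: ler_sum => n ns; rewrite -mulrBr !ComplexField.Normc.normcM.
apply: (@le_trans _ _ (normc (a n) * normc (z n) *
    (2 * `|2 * pi * n%:~R * t - 2 * pi * n%:~R * t'|))).
  by rewrite ler_wpM2l ?cexpi_lipschitz// mulr_ge0 ?normc_ge0.
rewrite -mulrBr !normrM (ger0_norm (pi_ge0 R)) (ger0_norm (ler0n R 2)).
have -> : 4 * pi * N%:R * (normc (a n) * normc (z n)) * `|t - t'| =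
  normc (a n) * normc (z n) * (2 * (2 * pi * N%:R * `|t - t'|)) by ring.
rewrite ler_wpM2l ?mulr_ge0 ?normc_ge0// ler_pM2l// ler_wpM2r// ler_wpM2l//.
  by rewrite mulr_ge0// pi_ge0.
by rewrite -intr_norm -abszE -pmulrn ler_nat sN.
Qed.

Lemma normc_trig_poly a s z t :
  normc (trig_poly a s z t) <= \sum_(n <- s) normc (a n) * normc (z n).
Proof.
apply: le_trans (normc_sum _ _) _; apply: ler_sum => n _.
by rewrite !ComplexField.Normc.normcM normc_cexpi mulr1.
Qed.

(** Above the threshold [al], the excess [|x| - al] is dominated by an
    exponential with rate [la], whose mean is computable for Gaussian [x]. *)
Lemma normr_le_expR (x al la : R) : 0 < la ->
  `|x| <= al + la^-1 * (expR (la * x) * expR (- (la * al)) +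
                         expR (- la * x) * expR (- (la * al))).
Proof.
move=> la0; rewrite -lerBlDl ler_pdivlMl//.
rewrite -!expRD; case: (ger0P x) => x0.
  apply: (@le_trans _ _ (expR (la * x - la * al))); last first.
    by rewrite lerDl expR_ge0.
  by apply: (le_trans _ (expR_ge1Dx _)); lra.
apply: (@le_trans _ _ (expR (- la * x - la * al))); last first.
  by rewrite lerDr expR_ge0.
by apply: (le_trans _ (expR_ge1Dx _)); lra.
Qed.

(** Periodicity and the Lipschitz bound reduce the supremum over the circle to
    the [M] points [i / M]; the exponentials bound the maximum over these
    points, whatever the threshold [al] and the scale [la]. *)
Lemma trig_poly_grid a s z (N M : nat) (al la : R) t :
  (forall n, n \in s -> (`|n| <= N)%N) -> (0 < M)%N -> 0 < la ->
  normc (trig_poly a s z t) <= 2 * al +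
    (la^-1 * expR (- (la * al)) *
      (\sum_(i < M)
        ((expR (la * complex.Re (trig_poly a s z (i%:R / M%:R))) +
          expR (- la * complex.Re (trig_poly a s z (i%:R / M%:R)))) +
         (expR (la * complex.Im (trig_poly a s z (i%:R / M%:R))) +
          expR (- la * complex.Im (trig_poly a s z (i%:R / M%:R)))))) +
     4 * pi * N%:R / M%:R * \sum_(n <- s) normc (a n) * normc (z n)).
Proof.
move=> sN M0 la0; set S := \sum_(n <- s) _.
have MR : 0 < M%:R :> R by rewrite ltr0n.
pose t' := t - (Num.floor t)%:~R.
have t'0 : 0 <= t' by rewrite subr_ge0 floor_le.
have t'1 : t' < 1 by rewrite ltrBlDl (_ : _ + 1 = (Num.floor t + 1)%:~R) ?floorD1_gt// intrD.
pose i0 := Num.truncn (M%:R * t').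
have /andP[il iu] : i0%:R <= M%:R * t' < i0.+1%:R.
  by apply: truncn_itv; rewrite mulr_ge0.
have iM : (i0 < M)%N.
  by rewrite -(ltr_nat R); apply: le_lt_trans il _; rewrite gtr_pMr.
pose i := Ordinal iM.
set p := trig_poly a s z.
have -> : p t = p t'.
  by rewrite /p -(trig_poly_periodic _ _ _ t' (Num.floor t)) subrK.
clearbody t'.
have hL : normc (p t' - p (i%:R / M%:R)) <= 4 * pi * N%:R / M%:R * S.
  apply: le_trans (trig_poly_lipschitz _ _ _ _ sN) _.
  rewrite -/S [leRHS]mulrAC ler_wpM2l//.
    by rewrite !mulr_ge0 ?pi_ge0// sumr_ge0// => n _; rewrite mulr_ge0 ?normc_ge0.
  rewrite ger0_norm; last by rewrite subr_ge0 ler_pdivrMr// mulrC.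
  rewrite lerBlDr -(ler_pM2r MR) mulrDl mulVf ?gt_eqF// mulfVK ?gt_eqF//.
  by rewrite mulrC addrC natr1 ltW.
rewrite -[p t'](subrK (p (i%:R / M%:R))).
apply: le_trans (le_normcD _ _) _; rewrite addrC addrA lerD//.
apply: le_trans (normc_le_Re_Im _) _.
set x := complex.Re _; set y := complex.Im _.
apply: (@le_trans _ _ (2 * al + la^-1 * expR (- (la * al)) *
   ((expR (la * x) + expR (- la * x)) + (expR (la * y) + expR (- la * y))))).
  have := lerD (normr_le_expR x al la0) (normr_le_expR y al la0).
  move=> /le_trans; apply; rewrite le_eqVlt; apply/orP; left; apply/eqP; ring.
rewrite lerD2l ler_wpM2l ?mulr_ge0 ?expR_ge0 ?invr_ge0 ?(ltW la0)//.
by rewrite (bigD1 i)//= lerDl sumr_ge0.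
Qed.

End TrigonometricPolynomials.

(** * Maximal inequality for Gaussian trigonometric polynomials *)

Section MeanBounds.
Context d (Omega : measurableType d) (R : realType) (P : probability Omega R).

(** Packing measurability and positivity with the bound on the mean makes such
    bounds stable under sums and nonnegative multiples. *)
Definition mean_le (X : Omega -> R) (u : R) :=
  [/\ measurable_fun setT X, forall w, 0 <= X w &
      (\int[P]_w (X w)%:E <= u%:E)%E].

Lemma mean_leD X Y u v :
  mean_le X u -> mean_le Y v -> mean_le (fun w => X w + Y w) (u + v).
Proof.
move=> [mX X0 Xu] [mY Y0 Yv]; split.
- exact: measurable_funD.
- by move=> w; exact: addr_ge0.
- under eq_integral do rewrite EFinD.
  rewrite ge0_integralD//; first by rewrite EFinD; exact: leeD.
  + by move=> w _; rewrite lee_fin.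
  + exact/measurable_EFinP.
  + by move=> w _; rewrite lee_fin.
  + exact/measurable_EFinP.
Qed.

Lemma mean_leZ k X u : 0 <= k -> mean_le X u ->
  mean_le (fun w => k * X w) (k * u).
Proof.
move=> k0 [mX X0 Xu]; split.
- exact: measurable_funM.
- by move=> w; exact: mulr_ge0.
- under eq_integral do rewrite EFinM.
  rewrite ge0_integralZl_EFin//.
  + by rewrite EFinM lee_wpmul2l// lee_fin.
  + by move=> w _; rewrite lee_fin.
  + exact/measurable_EFinP.
Qed.

Lemma mean_le0 : mean_le (fun=> 0) 0.
Proof. by split => //; rewrite integral0. Qed.

Lemma mean_le_sum I (s : seq I) (X : I -> Omega -> R) (u : I -> R) :
  (forall i, mean_le (X i) (u i)) ->
  mean_le (fun w => \sum_(i <- s) X i w) (\sum_(i <- s) u i).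
Proof.
move=> h; elim: s => [|i s ih].
  rewrite big_nil (_ : (fun _ => _) = fun=> 0); first exact: mean_le0.
  by apply/funext => w; rewrite big_nil.
rewrite big_cons (_ : (fun _ => _) = fun w => X i w + \sum_(i <- s) X i w).
  exact: mean_leD.
by apply/funext => w; rewrite big_cons.
Qed.

End MeanBounds.

Section GaussianSubspace.
Context d (Omega : measurableType d) (R : realType) (P : probability Omega R).

Lemma L2_integrable (X : Omega -> R[i]) : L2 P setT X ->
  P.-integrable setT (fun w => (complex.Re (X w))%:E) /\
  P.-integrable setT (fun w => (complex.Im (X w))%:E).
Proof.
move=> LX; have L1 : L2 P setT (fun=> 1 : R[i]).
  split; first by split; exact: measurable_cst.
  rewrite integral_cst//= probability_setT mule1.
  exact: ltry.
have [iR iI] := L2_integrable_mulJ LX L1.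
by split; [move: iR|move: iI]; apply: eq_integrable => // w _; rewrite rmorph1 mulr1.
Qed.

Definition centered (X : Omega -> R[i]) :=
  (\int[P]_w (complex.Re (X w))%:E = 0)%E /\
  (\int[P]_w (complex.Im (X w))%:E = 0)%E.

Lemma cexpectation_centered (X : Omega -> R[i]) :
  L2 P setT X -> cexpectation P X = 0 -> centered X.
Proof.
move=> /L2_integrable[iR iI] [eR eI].
split; first by rewrite -(fineK (integrable_fin_num measurableT iR)); congr EFin.
by rewrite -(fineK (integrable_fin_num measurableT iI)); congr EFin.
Qed.

Lemma centered_linear (c : R[i]) (X Y : Omega -> R[i]) :
  L2 P setT X -> L2 P setT Y -> centered X -> centered Y ->
  centered (fun w => c * X w + Y w).
Proof.
move=> /L2_integrable[iRX iIX] /L2_integrable[iRY iIY] [RX IX] [RY IY].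
have iZ (k : R) (Z : Omega -> R) : P.-integrable setT (EFin \o Z) ->
    P.-integrable setT (fun w => (k%:E * (Z w)%:E)%E) by move=> ?; exact: integrableZl.
split.
- under eq_integral do rewrite complex_ReD complex_ReM EFinD EFinB !EFinM.
  rewrite integralD//; last by apply: integrableB => //; exact: iZ.
  rewrite integralB//; [|exact: iZ..].
  by rewrite !integralZl// RX IX RY !mule0 sube0 adde0.
- under eq_integral do rewrite complex_ImD complex_ImM !EFinD !EFinM.
  rewrite integralD//; last by apply: integrableD => //; exact: iZ.
  rewrite integralD//; [|exact: iZ..].
  by rewrite !integralZl// RX IX IY !mule0 !adde0.
Qed.

(** Joint Gaussianity makes the real and the imaginary part Gaussian, and both
    are dominated by the modulus. *)
Lemma complex_gaussian_exp_moment (X : Omega -> R[i]) (sg l : R) :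
  L2 P setT X -> complex_gaussian P X -> centered X -> 0 < sg ->
  (\int[P]_w (normc (X w) ^+ 2)%:E <= (sg ^+ 2)%:E)%E ->
  mean_le P (fun w => expR (l * complex.Re (X w))) (expR (8 * l ^+ 2 * sg ^+ 2)) /\
  mean_le P (fun w => expR (l * complex.Im (X w))) (expR (8 * l ^+ 2 * sg ^+ 2)).
Proof.
move=> [[mR mI] _] gX [XR XI] sg0 X2.
have mexp (Z : Omega -> R) : measurable_fun setT Z ->
    measurable_fun setT (fun w => expR (l * Z w)).
  by move=> mZ; apply: measurableT_comp => //; exact: measurable_funM.
have mn := measurable_normc_sqr (conj mR mI).
have le2 (Z : Omega -> R) : measurable_fun setT Z -> (forall w, `|Z w| <= normc (X w)) ->
    (\int[P]_w ((Z w) ^+ 2)%:E <= (sg ^+ 2)%:E)%E.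
  move=> mZ Zle; apply: le_trans X2; apply: ge0_le_integral => //.
  - by move=> w _; rewrite lee_fin sqr_ge0.
  - by apply/measurable_EFinP; exact: measurable_funX.
  - move=> w _; rewrite lee_fin -(real_normK (num_real (Z w))).
    by rewrite lerXn2r// nnegrE ?normc_ge0.
split; split=> //.
- exact: mexp.
- apply: gaussian_exp_moment => //.
    by have := gX 1 0; under eq_fun do rewrite mul1r mul0r addr0.
  by apply: le2 => // w; exact: normr_Re_le.
- exact: mexp.
- apply: gaussian_exp_moment => //.
    by have := gX 0 1; under eq_fun do rewrite mul1r mul0r add0r.
  by apply: le2 => // w; exact: normr_Im_le.
Qed.

Lemma trig_poly_subspace (H : set (Omega -> R[i])) (xi : int -> Omega -> R[i])
    (a : int -> R[i]) (s : seq int) (t : R) :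
  closed_L2_subspace P H -> (forall n, H (xi n)) -> (forall n, centered (xi n)) ->
  H (fun w => trig_poly a s (xi ^~ w) t) /\
  centered (fun w => trig_poly a s (xi ^~ w) t).
Proof.
move=> [HL2 H0 Hlin _] Hxi cxi; elim: s => [|n s [ihH ihc]].
  rewrite (_ : (fun _ => _) = cst 0).
    by split=> //; split; rewrite integral0.
  by apply/funext => w; rewrite /trig_poly big_nil.
have -> : (fun w => trig_poly a (n :: s) (xi ^~ w) t) =
    (fun w => (a n * cexpi (2 * pi * n%:~R * t)) * xi n w +
              trig_poly a s (xi ^~ w) t).
  by apply/funext => w; rewrite /trig_poly big_cons mulrAC.
split; first exact: Hlin.
by apply: centered_linear => //; exact: HL2.
Qed.

Lemma mean_le_normc (X : Omega -> R[i]) : L2 P setT X ->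
  (\int[P]_w (normc (X w) ^+ 2)%:E = 1)%E -> mean_le P (fun w => normc (X w)) 1.
Proof.
move=> [[mR mI] _] X1.
have mn : measurable_fun setT (fun w => normc (X w)).
  rewrite (_ : (fun _ => _) = fun w => Num.sqrt (complex.Re (X w) ^+ 2 + complex.Im (X w) ^+ 2)).
    apply: (measurableT_comp (continuous_measurable_fun (@sqrt_continuous R))).
    by apply: measurable_funD; exact: measurable_funX.
  by apply/funext => w; case: (X w).
split => //; first by move=> w; exact: normc_ge0.
have [_ _] : mean_le P (fun w => 2^-1 * (1 + normc (X w) ^+ 2)) (2^-1 * (1 + 1)).
  apply: mean_leZ; first by rewrite invr_ge0.
  apply: mean_leD.
    by split => //; rewrite integral_cst//= probability_setT mule1.
  split; [exact: measurable_funX|by move=> w; exact: sqr_ge0|by rewrite X1].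
rewrite (_ : 2^-1 * (1 + 1) = 1 :> R); last by field.
apply: le_trans; apply: ge0_le_integral => //.
- by move=> w _; rewrite lee_fin normc_ge0.
- exact/measurable_EFinP.
- apply/measurable_EFinP; apply: measurable_funM => //.
  by apply: measurable_funD => //; exact: measurable_funX.
- move=> w _; rewrite lee_fin; have := sqr_ge0 (normc (X w) - 1).
  by move: (normc _) => u; nra.
Qed.

(** A Salem-Zygmund inequality: the variable [W] of [trig_poly_grid] has a mean
    controlled by the [4 * M] exponential moments on the grid, plus the
    Lipschitz term, where the mean of [|xi n|] is at most 1.  The threshold, the
    rate and the size of the grid are left free. *)
Lemma trig_poly_sup_mean (H : set (Omega -> R[i])) (xi : int -> Omega -> R[i])
    (a : int -> R[i]) (s : seq int) (N M : nat) (sg al la : R) :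
  closed_L2_subspace P H -> (forall X, H X -> complex_gaussian P X) ->
  (forall n, H (xi n)) -> (forall n, centered (xi n)) ->
  (forall n, \int[P]_w (normc (xi n w) ^+ 2)%:E = 1)%E ->
  (forall n, n \in s -> (`|n| <= N)%N) -> (0 < M)%N -> 0 < la -> 0 < sg ->
  (forall t, \int[P]_w (normc (trig_poly a s (xi ^~ w) t) ^+ 2)%:E <= (sg ^+ 2)%:E)%E ->
  exists2 W : Omega -> R,
    mean_le P W (la^-1 * expR (- (la * al)) *
                 (M%:R * (4 * expR (8 * la ^+ 2 * sg ^+ 2))) +
                 4 * pi * N%:R / M%:R * \sum_(n <- s) normc (a n)) &
    forall w t, normc (trig_poly a s (xi ^~ w) t) <= 2 * al + W w.
Proof.
move=> Hsub Hg Hxi cxi xi1 sN M0 la0 sg0 s2.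
have [HL2 _ _ _] := Hsub.
pose p (i : nat) w := trig_poly a s (xi ^~ w) (i%:R / M%:R).
pose e := expR (8 * la ^+ 2 * sg ^+ 2).
exists (fun w => la^-1 * expR (- (la * al)) *
    (\sum_(0 <= i < M) ((expR (la * complex.Re (p i w)) + expR (- la * complex.Re (p i w))) +
                (expR (la * complex.Im (p i w)) + expR (- la * complex.Im (p i w))))) +
    4 * pi * N%:R / M%:R * \sum_(n <- s) normc (a n) * normc (xi n w)); last first.
  move=> w t; rewrite [in leRHS]big_mkord; exact: trig_poly_grid.
have [L0 e0] : 0 <= la^-1 /\ 0 <= 4 * pi * N%:R / M%:R :> R.
  by rewrite invr_ge0 ltW// !mulr_ge0 ?pi_ge0// invr_ge0.
apply: mean_leD.
  apply: mean_leZ; first by rewrite mulr_ge0 ?expR_ge0.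
  have -> : M%:R * (4 * e) = \sum_(0 <= i < M) ((e + e) + (e + e)).
    by rewrite sumr_const_nat subn0 -[RHS]mulr_natl; congr (_ * _); ring.
  apply: mean_le_sum => i.
  have [Hp cp] := trig_poly_subspace a s (i%:R / M%:R) Hsub Hxi cxi.
  have [R1 I1] := complex_gaussian_exp_moment la (HL2 _ Hp) (Hg _ Hp) cp sg0 (s2 _).
  have [R2 I2] := complex_gaussian_exp_moment (- la) (HL2 _ Hp) (Hg _ Hp) cp sg0 (s2 _).
  rewrite sqrrN in R2 I2.
  by apply: mean_leD; apply: mean_leD.
apply: mean_leZ => //; apply: mean_le_sum => n.
rewrite -[X in mean_le _ _ X]mulr1.
apply: mean_leZ; first exact: normc_ge0.
by apply: mean_le_normc => //; exact: HL2.
Qed.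

End GaussianSubspace.

(** * Summable uniform bounds on the blocks *)

Section DyadicNumbers.
Context {R : realType}.

Lemma dyadic_ge2 j : (2 <= dyadic j)%N.
Proof. by rewrite /dyadic -{1}(expn1 2) leq_exp2l// expn_gt0. Qed.

Lemma dyadicS j : dyadic j.+1 = (dyadic j ^ 2)%N.
Proof. by rewrite /dyadic expnSr expnM. Qed.

Lemma dyadic_mono i j : (i <= j)%N -> (dyadic i <= dyadic j)%N.
Proof. by move=> ij; rewrite /dyadic !leq_exp2l. Qed.

Lemma dyadic_le_expR j : (dyadic j)%:R <= expR (2 ^ j)%:R :> R.
Proof.
rewrite /dyadic natrX -[X in expR X]mulr1 expRM_natl lerXn2r// ?nnegrE ?expR_ge0//.
by apply: (le_trans _ (expR_ge1Dx _)).
Qed.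

Lemma sum_geometric_half k : \sum_(j < k) (2^-1 : R) ^+ j <= 2.
Proof.
suff -> : \sum_(j < k) (2^-1 : R) ^+ j = 2 - 2 * 2^-1 ^+ k.
  by rewrite lerBlDr lerDl mulr_ge0// exprn_ge0// invr_ge0.
elim: k => [|k ih]; first by rewrite big_ord0 expr0; ring.
by rewrite big_ord_recr/= ih exprS; field.
Qed.

End DyadicNumbers.

Section DyadicBlocks.
Context d (Omega : measurableType d) (R : realType) (P : probability Omega R).

(** On the block ]dyadic j, dyadic j.+1] a grid of [dyadic j.+2] points is fine
    enough for the crude Lipschitz bound, and the logarithm of its cardinality
    is of order [2 ^ j]: the maximum is [sqrt 2 ^+ j] standard deviations. *)
Lemma dyadic_blocks (H : set (Omega -> R[i])) (xi : int -> Omega -> R[i])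
    (a : int -> R[i]) (T : nat -> R) (K B : R) :
  closed_L2_subspace P H -> (forall X, H X -> complex_gaussian P X) ->
  (forall n, H (xi n)) -> (forall n, centered P (xi n)) ->
  (forall n, \int[P]_w (normc (xi n w) ^+ 2)%:E = 1)%E ->
  (forall n, 0 <= T n) -> 0 <= K ->
  (forall k n, (2 <= k)%N -> (k <= `|n|)%N -> normc (a n) <= T k) ->
  (forall k N t, (2 <= k)%N -> (k <= N)%N ->
    \int[P]_w (normc (trig_poly a (sym_block k N) (xi ^~ w) t) ^+ 2)%:E <=
    (K ^+ 2 * T k ^+ 2)%:E)%E ->
  (forall k, \sum_(j < k) Num.sqrt 2 ^+ j * T (dyadic j) <= B) ->
  exists V : nat -> Omega -> R, exists v : nat -> R, exists B' : R,
    [/\ forall j, mean_le P (V j) (v j),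
        forall k, \sum_(j < k) v j <= B' &
        forall j w t,
          normc (trig_poly a (sym_block (dyadic j) (dyadic j.+1)) (xi ^~ w) t) <= V j w].
Proof.
move=> Hsub Hg Hxi cxi xi1 T0 K0 aT s2T TB.
pose q j : R := Num.sqrt 2 ^+ j.
have q1 j : 1 <= q j.
  by rewrite exprn_ege1// -[leLHS]sqrtr1 ler_wsqrtr// ler1n.
have q0 j : 0 < q j by exact: lt_le_trans (q1 j).
(* the summand 2^-j / q j keeps the standard deviation positive *)
pose sg j := K * T (dyadic j) + (q j)^-1 * 2^-1 ^+ j.
have sg0 j : 0 < sg j.
  by rewrite ltr_wpDl ?mulr_ge0// mulr_gt0 ?invr_gt0// exprn_gt0// invr_gt0.
pose v j := 2 * (12 * sg j * q j) + (4 * (sg j / q j) + 12 * pi * T (dyadic j)).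
have blk j : exists V : Omega -> R, mean_le P V (v j) /\ forall w t,
    normc (trig_poly a (sym_block (dyadic j) (dyadic j.+1)) (xi ^~ w) t) <= V w.
  set s := sym_block _ _; pose N := dyadic j.+1; pose M := dyadic j.+2.
  have N0 : 0 < N%:R :> R by rewrite ltr0n (leq_trans _ (dyadic_ge2 _)).
  have MN : M%:R = N%:R ^+ 2 :> R by rewrite /M dyadicS natrX.
  (* rate q / sg and threshold 12 sg q: the exponent 8 q^2 - 12 q^2 of the
     moment bound compensates the number M <= expR (4 q^2) of grid points *)
  have la0 : 0 < q j / sg j by rewrite divr_gt0.
  have s2 t : (\int[P]_w (normc (trig_poly a s (xi ^~ w) t) ^+ 2)%:E <=
      (sg j ^+ 2)%:E)%E.
    apply: le_trans (s2T _ _ t (dyadic_ge2 j) (dyadic_mono (leqnSn j))) _.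
    rewrite lee_fin -exprMn lerXn2r ?nnegrE ?mulr_ge0 ?(ltW (sg0 j))//.
    by rewrite lerDl mulr_ge0 ?invr_ge0 ?(ltW (q0 j))// exprn_ge0// invr_ge0.
  have sN n : n \in s -> (`|n| <= N)%N by rewrite mem_sym_block => /andP[].
  have M0 : (0 < M)%N by rewrite (leq_trans _ (dyadic_ge2 _)).
  have [W [mW W0 Wle] Wb] :=
    trig_poly_sup_mean (12 * sg j * q j) Hsub Hg Hxi cxi xi1 sN M0 la0 (sg0 j) s2.
  exists (fun w => 2 * (12 * sg j * q j) + W w); split; last by [].
  apply: mean_leD.
    split; [by []| |by rewrite integral_cst//= probability_setT mule1].
    by move=> _; rewrite !mulr_ge0 ?(ltW (sg0 j))// ltW.
  split=> //; apply: (le_trans Wle); rewrite lee_fin; apply: lerD.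
    have -> : (q j / sg j)^-1 = sg j / q j by rewrite invf_div.
    have -> : q j / sg j * (12 * sg j * q j) = 12 * (2 ^ j)%:R.
      by rewrite -sqrt2X -/(q j); field; rewrite gt_eqF.
    have -> : 8 * (q j / sg j) ^+ 2 * sg j ^+ 2 = 8 * (2 ^ j)%:R.
      by rewrite -sqrt2X -/(q j); field; rewrite gt_eqF.
    have -> : sg j / q j * expR (- (12 * (2 ^ j)%:R)) *
        (M%:R * (4 * expR (8 * (2 ^ j)%:R))) =
        4 * (sg j / q j) * (M%:R * (expR (8 * (2 ^ j)%:R) * expR (- (12 * (2 ^ j)%:R)))).
      by ring.
    rewrite -[leRHS]mulr1 ler_wpM2l ?mulr_ge0 ?invr_ge0 ?(ltW (sg0 j)) ?(ltW (q0 j))//.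
    rewrite -expRD; have -> : 8 * (2 ^ j)%:R - 12 * (2 ^ j)%:R = - (2 ^ j.+2)%:R :> R.
      by rewrite !expnS !natrM; ring.
    by rewrite expRN ler_pdivrMr ?expR_gt0// mul1r dyadic_le_expR.
  (* the block has at most 2 N + 1 <= 3 N frequencies *)
  apply: (@le_trans _ _ (4 * pi * N%:R / M%:R * (3 * N%:R * T (dyadic j)))).
    rewrite ler_wpM2l ?mulr_ge0 ?pi_ge0 ?invr_ge0//.
    apply: (@le_trans _ _ (\sum_(n <- s) T (dyadic j))).
      rewrite [leLHS]big_seq [leRHS]big_seq; apply: ler_sum => n.
      rewrite mem_sym_block => /andP[nj _].
      by apply: aT; [exact: dyadic_ge2|exact: ltnW].
    rewrite big_const_seq count_predT iter_addr_0 -[leLHS]mulr_natl ler_wpM2r// -natrM ler_nat.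
    rewrite size_filter; apply: leq_trans (count_size _ _) _.
    rewrite size_sym_range -muln2 mulnC.
    have := dyadic_ge2 j.+1; rewrite -/N; lia.
  rewrite MN le_eqVlt; apply/orP; left; apply/eqP; field.
  by rewrite gt_eqF.
have [V hV] := choice blk.
exists V, v, ((28 * K + 12 * pi) * B + 28 * 2); split.
- by move=> j; have [] := hV j.
- move=> k.
  apply: (@le_trans _ _ (\sum_(j < k) ((28 * K + 12 * pi) * (q j * T (dyadic j)) +
      28 * 2^-1 ^+ j))).
    apply: ler_sum => j _.
    have i1 : (q j)^-1 <= q j.
      by apply: (@le_trans _ _ 1) => //; rewrite invf_le1.
    have sgq : sg j * q j = K * (q j * T (dyadic j)) + 2^-1 ^+ j.
      by rewrite /sg; field; rewrite gt_eqF.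
    have h1 : sg j / q j <= sg j * q j by rewrite ler_pM2l.
    have h2 : pi * T (dyadic j) <= pi * (q j * T (dyadic j)) :> R.
      by rewrite ler_wpM2l ?pi_ge0// -[leLHS]mul1r ler_wpM2r.
    move: h1 h2 sgq; rewrite /v; move: (sg j / q j) (sg j) (q j) (2^-1 ^+ j) => x y z u.
    lra.
  rewrite big_split/= -!mulr_sumr lerD//.
    by apply: ler_wpM2l; [rewrite addr_ge0 ?mulr_ge0 ?pi_ge0|exact: TB].
  by rewrite ler_pM2l// sum_geometric_half.
- by move=> j w t; have [_] := hV j.
Qed.

End DyadicBlocks.

(** * Uniform limits of processes with dominated increments *)

Section DominatedIncrements.
Context {R : realType}.

(** The rate of convergence depends on the majorant [v] alone, which is what
    makes the convergence of the processes below uniform in time. *)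
Lemma dominated_increments_cvg (u v : nat -> R) :
  (forall j, `|u j.+1 - u j| <= v j) -> cvgn (series v) ->
  cvgn u /\ forall m, `|limn u - u m| <= limn (series v) - series v m.
Proof.
move=> uv cv.
have v0 j : 0 <= v j by apply: le_trans (uv j).
pose e j := u j.+1 - u j.
have ce : cvgn (series e).
  by apply: normed_cvg; apply: (series_le_cvg _ v0 _ cv) => j; [exact: normr_ge0|exact: uv].
have uE : u = (fun n => u 0%N + series e n).
  apply/funext => n; rewrite /series/= /e telescope_sumr//.
  by rewrite addrC subrK.
have cu : cvgn u.
  by rewrite uE; apply: is_cvgD => //; exact: is_cvg_cst.
split=> // m.
have inc n : (m <= n)%N -> `|u n - u m| <= series v n - series v m.
  move=> mn; rewrite sub_series_geq//.
  have -> : u n - u m = \sum_(m <= k < n) (u k.+1 - u k) by rewrite telescope_sumr.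
  by apply: le_trans (ler_norm_sum _ _ _) _; exact: ler_sum.
have cl : (fun n => `|u n - u m|) @ \oo --> `|limn u - u m|.
  by apply: cvg_norm; apply: cvgB => //; exact: cvg_cst.
apply: (cvgr_to_le cl); exists m => // n /= mn; apply: le_trans (inc n mn) _.
rewrite lerD2r; apply: nondecreasing_cvgn_le => //.
by apply: nondecreasing_series => // k _ _.
Qed.

Lemma tail_series_cvg0 (v : nat -> R) (e : R) : cvgn (series v) -> 0 < e ->
  exists m, limn (series v) - series v m < e.
Proof.
move=> cv e0; have /cvgrPdist_lt/(_ e e0)[m _ hm] := cv.
by exists m; apply: le_lt_trans (ler_norm _) _; apply: hm => /=.
Qed.

End DominatedIncrements.

Section UniformLimit.
Context d (Omega : measurableType d) (R : realType) (P : probability Omega R).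

Lemma summable_mean_ae (V : nat -> Omega -> R) (v : nat -> R) (B : R) :
  (forall j, mean_le P (V j) (v j)) -> (forall k, \sum_(j < k) v j <= B) ->
  exists2 G : set Omega, measurable G &
    (\forall w \ae P, G w) /\ forall w, G w -> cvgn (series (V ^~ w)).
Proof.
move=> mV vB.
pose F w : \bar R := (\sum_(j <oo) (V j w)%:E)%E.
have V0 j w : (0 <= (V j w)%:E)%E by rewrite lee_fin; have [_ ->] := mV j.
have mVj j : measurable_fun setT (fun w => (V j w)%:E).
  by apply/measurable_EFinP; have [] := mV j.
have mF : measurable_fun setT F by exact: ge0_emeasurable_sum.
have F0 w : (0 <= F w)%E by apply: nneseries_ge0.
have Fle : (\int[P]_w F w <= B%:E)%E.
  rewrite integral_nneseries//; apply: lime_le.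
    by apply: is_cvg_ereal_nneg_natsum => j _; apply: integral_ge0.
  apply: nearW => k; apply: (@le_trans _ _ (\sum_(0 <= j < k) (v j)%:E)%E).
    by apply: lee_sum => j _; have [] := mV j.
  by rewrite sumEFin lee_fin big_mkord.
have iF : P.-integrable setT F.
  apply/integrableP; split => //.
  under eq_integral do rewrite gee0_abs//.
  exact: le_lt_trans Fle (ltry _).
exists [set w | F w \is a fin_num].
  by rewrite -[X in measurable X]setTI; exact: emeasurable_fin_num.
split.
  by have := integrable_ae measurableT iF; apply: filterS => w /(_ Logic.I).
move=> w /= Fw; apply: nondecreasing_is_cvgn.
  by apply: nondecreasing_series => // k _ _; rewrite -lee_fin.
exists (fine (F w)) => _ [k _ <-].
rewrite -lee_fin fineK// /series/= -sumEFin.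
exact: nneseries_lim_ge.
Qed.

(** Processes with Lipschitz paths whose increments are dominated, uniformly in
    time, by variables with summable means converge almost surely uniformly;
    the limit has continuous bounded paths, hence is separable. *)
Lemma uniform_limit_process (S_ : nat -> R -> Omega -> R[i])
    (V : nat -> Omega -> R) (v : nat -> R) (B : R) :
  (forall j t, cmeasurable setT (S_ j t)) ->
  (forall j, circle_process (S_ j)) ->
  (forall j w, exists L : R, forall s t, normc (S_ j s w - S_ j t w) <= L * `|s - t|) ->
  (forall w, exists M : R, forall t, normc (S_ 0%N t w) <= M) ->
  (forall j, mean_le P (V j) (v j)) -> (forall k, \sum_(j < k) v j <= B) ->
  (forall j w t, normc (S_ j.+1 t w - S_ j t w) <= V j w) ->
  exists S : R -> Omega -> R[i],
    [/\ circle_process S, forall t, cmeasurable setT (S t),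
        separable_process P S,
        \forall w \ae P, exists M : R, forall t, normc (S t w) <= M &
        \forall w \ae P, forall t,
          (fun j => normc (S_ j t w - S t w)) @ \oo --> (0 : R)].
Proof.
move=> mS perS lipS bS mV vB SV.
have [G mG [aeG cG]] := summable_mean_ae mV vB.
pose uR t w j := complex.Re (S_ j t w).
pose uI t w j := complex.Im (S_ j t w).
(* off G the path is set to 0, which keeps every path periodic and every S t
   measurable *)
pose S t w : R[i] := if `[< G w >] then Complex (limn (uR t w)) (limn (uI t w)) else 0.
pose rho w m := limn (series (V ^~ w)) - series (V ^~ w) m.
have hR t w : G w -> cvgn (uR t w) /\ forall m, `|limn (uR t w) - uR t w m| <= rho w m.
  move=> Gw; apply: dominated_increments_cvg (cG w Gw) => j.
  by rewrite /uR -complex_ReN -complex_ReD; apply: le_trans (SV j w t); exact: normr_Re_le.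
have hI t w : G w -> cvgn (uI t w) /\ forall m, `|limn (uI t w) - uI t w m| <= rho w m.
  move=> Gw; apply: dominated_increments_cvg (cG w Gw) => j.
  by rewrite /uI -complex_ImN -complex_ImD; apply: le_trans (SV j w t); exact: normr_Im_le.
have SE t w : G w -> S t w = Complex (limn (uR t w)) (limn (uI t w)).
  by move=> Gw; rewrite /S; case: asboolP.
have hS t w m : G w -> normc (S t w - S_ m t w) <= 2 * rho w m.
  move=> Gw; apply: le_trans (normc_le_Re_Im _) _.
  rewrite SE// complex_ReD complex_ReN complex_ImD complex_ImN/= mulr_natl mulr2n.
  by apply: lerD; [have [_] := hR t w Gw; exact|have [_] := hI t w Gw; exact].
have distS w s t m : G w ->
    normc (S s w - S t w) <= 4 * rho w m + normc (S_ m s w - S_ m t w).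
  move=> Gw.
  have -> : S s w - S t w = (S s w - S_ m s w) + ((S_ m s w - S_ m t w) - (S t w - S_ m t w)).
    by ring.
  apply: le_trans (le_normcD _ _) _.
  have h := le_normcD (S_ m s w - S_ m t w) (- (S t w - S_ m t w)).
  rewrite normcN in h.
  have := hS s w m Gw; have := hS t w m Gw; lra.
exists S; split.
- move=> w t; rewrite /S; congr (if _ then Complex (limn _) (limn _) else _);
    by apply/funext => j; rewrite /uR /uI perS.
- move=> t; split.
  + apply: (@measurable_fun_cvg _ _ _ setT (fun m w => \1_G w * uR t w m)).
      move=> m; apply: measurable_funM; first exact: measurable_indic.
      by have [] := mS m t.
    move=> w _; rewrite indicE /S; case: asboolP => Gw.
      rewrite mem_set//=; under eq_fun do rewrite mul1r.
      by have [] := hR t w Gw.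
    by rewrite memNset//=; under eq_fun do rewrite mul0r; exact: cvg_cst.
  + apply: (@measurable_fun_cvg _ _ _ setT (fun m w => \1_G w * uI t w m)).
      move=> m; apply: measurable_funM; first exact: measurable_indic.
      by have [] := mS m t.
    move=> w _; rewrite indicE /S; case: asboolP => Gw.
      rewrite mem_set//=; under eq_fun do rewrite mul1r.
      by have [] := hI t w Gw.
    by rewrite memNset//=; under eq_fun do rewrite mul0r; exact: cvg_cst.
(* the rationals determine the paths on G, which are continuous as uniform
   limits of Lipschitz paths *)
- exists (range (@ratr R)).
    by apply: (card_le_trans (card_image_le _ _)); exact: countableP.
  apply: filterS aeG => w Gw t.
  pose u k : R := ratr ((Num.floor (t * k.+1%:R))%:~R / k.+1%:R).
  have ub k : `|u k - t| <= k.+1%:R^-1.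
    have k0 : 0 < k.+1%:R :> R by rewrite ltr0n.
    rewrite /u rmorphM/= fmorphV/= ratr_int ratr_nat.
    rewrite distrC ger0_norm; last by rewrite subr_ge0 ler_pdivrMr// floor_le.
    rewrite lerBlDr -[t in leLHS](mulfK (lt0r_neq0 k0)).
    rewrite -[X in _ <= X + _]mul1r -mulrDl ler_pM2r ?invr_gt0// addrC; apply: ltW.
    by apply: lt_le_trans (floorD1_gt _) _; rewrite intrD.
  have uinv (e : R) : 0 < e -> \forall k \near \oo, k.+1%:R^-1 < e.
    by move=> e0; exact: near_infty_natSinv_lt (PosNum e0).
  exists u; split; first by move=> k; exists ((Num.floor (t * k.+1%:R))%:~R / k.+1%:R).
  + apply/cvgrPdist_lt => e /uinv; apply: filterS => k ke.
    by rewrite distrC; exact: le_lt_trans (ub k) ke.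
  + apply/cvgrPdist_lt => e e0.
    have [m rm] := tail_series_cvg0 (cG w Gw) (divr_gt0 e0 (ltr0n R 8)).
    have [L hL] := lipS m w.
    have L0 : 0 < `|L| + 1 by rewrite ltr_wpDl.
    have e1 : 0 < e / 2 / (`|L| + 1) by rewrite !divr_gt0.
    move: (uinv _ e1); apply: filterS => k ke.
    rewrite sub0r normrN ger0_norm ?normc_ge0//.
    apply: le_lt_trans (distS w _ _ m Gw) _.
    have h : normc (S_ m (u k) w - S_ m t w) < e / 2.
      apply: le_lt_trans (hL _ _) _; move: ke; rewrite ltr_pdivlMr// => ke.
      apply: le_lt_trans _ ke.
      apply: (@le_trans _ _ ((`|L| + 1) * `|u k - t|)).
        rewrite ler_wpM2r//; apply: le_trans (ler_norm L) _.
        by rewrite lerDl.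
      by rewrite mulrC ler_pM2r.
    move: rm h; rewrite -/(rho w m); lra.
- apply: filterS aeG => w Gw; have [M hM] := bS w.
  exists (2 * rho w 0%N + M) => t.
  rewrite -[S t w](subrK (S_ 0%N t w)); apply: le_trans (le_normcD _ _) _.
  by apply: lerD; [exact: hS|exact: hM].
- apply: filterS aeG => w Gw t; apply/cvgrPdist_lt => e e0.
  have /cvgrPdist_lt/(_ (e / 2) _)[|m _ hm] := cG w Gw; first by rewrite divr_gt0.
  exists m => // n /= mn; rewrite sub0r normrN ger0_norm ?normc_ge0//.
  rewrite -normcN opprB; apply: le_lt_trans (hS t w n Gw) _.
  have := hm n mn; rewrite -/(rho w n) => /(le_lt_trans (ler_norm _)); lra.
Qed.

End UniformLimit.

(** * Identification of the limit in L2 *)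

Section L2Limits.
Context d (Omega : measurableType d) (R : realType) (P : probability Omega R).

Lemma cmeasurableB (X Y : Omega -> R[i]) :
  cmeasurable setT X -> cmeasurable setT Y -> cmeasurable setT (fun w => X w - Y w).
Proof.
move=> [X1 X2] [Y1 Y2]; split.
  by under eq_fun do rewrite complex_ReD complex_ReN; exact: measurable_funB.
by under eq_fun do rewrite complex_ImD complex_ImN; exact: measurable_funB.
Qed.

(** Fatou's lemma: an almost sure limit inherits a uniform bound on the [L2]
    distance to a fixed variable. *)
Lemma L2_dist_limit_le (X Y : Omega -> R[i]) (Y_ : nat -> Omega -> R[i]) (C : R) :
  cmeasurable setT X -> cmeasurable setT Y -> (forall j, cmeasurable setT (Y_ j)) ->
  (\forall w \ae P, (fun j => normc (Y_ j w - Y w)) @ \oo --> (0 : R)) ->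
  (forall j, \int[P]_w (normc (X w - Y_ j w) ^+ 2)%:E <= C%:E)%E ->
  (\int[P]_w (normc (X w - Y w) ^+ 2)%:E <= C%:E)%E.
Proof.
move=> mX mY mY_ YY le.
pose g j w := (normc (X w - Y_ j w) ^+ 2)%:E.
have mg j : measurable_fun setT (g j) by apply: measurable_normc_sqr; exact: cmeasurableB.
have -> : (\int[P]_w (normc (X w - Y w) ^+ 2)%:E =
    \int[P]_w limn_einf (g ^~ w))%E.
  apply: ae_eq_integral => //.
  - by apply: measurable_normc_sqr; exact: cmeasurableB.
  - rewrite /limn_einf; apply: measurableT_comp => //.
    apply: (measurable_fun_limn_esup (f := fun n w => (- g n w)%E)) => n.
    exact: measurableT_comp.
  - apply: filterS YY => w Yw _.
    have cg : g ^~ w @ \oo --> (normc (X w - Y w) ^+ 2)%:E.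
      apply: cvg_EFin; first exact: nearW.
      have cn : (fun j => normc (X w - Y_ j w)) @ \oo --> normc (X w - Y w).
        apply/cvgrPdist_lt => e e0; move/cvgrPdist_lt : Yw => /(_ e e0).
        apply: filterS => j; rewrite sub0r normrN ger0_norm ?normc_ge0//.
        apply: le_lt_trans.
        have h1 := le_normcD (X w - Y_ j w) (Y_ j w - Y w).
        have h2 := le_normcD (X w - Y w) (- (Y_ j w - Y w)).
        rewrite normcN in h2.
        rewrite addrA subrK in h1; rewrite opprB addrA subrK in h2.
        by rewrite ler_norml; apply/andP; split; lra.
      rewrite expr2 (_ : fine \o _ =
          fun j => normc (X w - Y_ j w) * normc (X w - Y_ j w)).
        exact: cvgM.
      by apply/funext => j; rewrite /g/= expr2.
    by rewrite (is_cvg_limn_einfE (cvgP _ cg)); apply/esym/cvg_lim.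
apply: (le_trans (fatou _ measurableT mg _)).
  by move=> j w _; rewrite lee_fin sqr_ge0.
rewrite limn_einf_lim; apply: lime_le; first exact: is_cvg_einfs.
apply: nearW => j; apply: le_trans (le j); apply: ereal_inf_lbound.
by exists j => /=.
Qed.

Lemma L2_of_dist (X Y : Omega -> R[i]) (C : R) :
  L2 P setT X -> cmeasurable setT Y ->
  (\int[P]_w (normc (X w - Y w) ^+ 2)%:E <= C%:E)%E -> L2 P setT Y.
Proof.
move=> [mX X2] mY XY; split=> //.
have sqmean (Z : Omega -> R[i]) u : cmeasurable setT Z ->
    (\int[P]_w (normc (Z w) ^+ 2)%:E <= u%:E)%E ->
    mean_le P (fun w => normc (Z w) ^+ 2) u.
  move=> mZ Zu; split=> //; last by move=> w; exact: sqr_ge0.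
  by apply/measurable_EFinP; exact: measurable_normc_sqr.
have X2' : (\int[P]_w (normc (X w) ^+ 2)%:E <= (fine (\int[P]_w (normc (X w) ^+ 2)%:E))%:E)%E.
  rewrite fineK// ge0_fin_numE//; apply: integral_ge0 => w _.
  by rewrite lee_fin sqr_ge0.
have [mf _ fle] := mean_leZ (ler0n R 2) (mean_leD (sqmean _ _ mX X2')
  (sqmean _ _ (cmeasurableB mX mY) XY)).
apply: le_lt_trans (ltry _); apply: le_trans fle.
apply: ge0_le_integral => //.
- by move=> w _; rewrite lee_fin sqr_ge0.
- exact: measurable_normc_sqr.
- exact/measurable_EFinP.
- move=> w _; rewrite lee_fin.
  have := le_normcD (X w) (- (X w - Y w)); rewrite normcN opprB addrC subrK.
  have := normc_ge0 (Y w); have := sqr_ge0 (normc (X w) - normc (X w - Y w)).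
  by move: (normc _) (normc _) (normc _) => x y z; nra.
Qed.

End L2Limits.

(** * The random series *)

Section TailDecay.
Context {R : realType}.

(** As [T] is nonincreasing, the [k]-th partial sum is at least
    [k * T (dyadic k)]. *)
Lemma double_dyadic_tail_cvg0 (T : nat -> R) (B : R) :
  (forall n, 0 <= T n) ->
  (forall m n, (2 <= m)%N -> (m <= n)%N -> T n <= T m) ->
  (forall k, \sum_(j < k) Num.sqrt 2 ^+ j * T (dyadic j) <= B) ->
  T @ \oo --> (0 : R).
Proof.
move=> T0 Td TB; apply/cvgrPdist_lt => e e0.
have kT k : k%:R * T (dyadic k) <= B.
  apply: le_trans (TB k).
  rewrite mulr_natl -[X in _ *+ X]card_ord -sumr_const; apply: ler_sum => j _.
  rewrite -[leLHS]mul1r ler_pM//; last exact: Td (dyadic_ge2 _) (dyadic_mono (ltnW _)).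
  by rewrite exprn_ege1// -[leLHS]sqrtr1 ler_wsqrtr// ler1n.
pose k := (Num.truncn (B / e)).+1.
have ke : B < k%:R * e by rewrite -ltr_pdivrMr// truncnS_gt.
have k0 : 0 < k%:R :> R by rewrite ltr0n.
exists (dyadic k) => // n /= kn; rewrite sub0r normrN ger0_norm//.
apply: le_lt_trans (Td _ _ (dyadic_ge2 k) kn) _.
by rewrite -(ltr_pM2l k0); apply: le_lt_trans (kT k) ke.
Qed.

End TailDecay.

Section MainEstimate.
Context d (Omega : measurableType d) (R : realType) (P : probability Omega R).

Lemma trig_poly_block (a : int -> R[i]) (z : int -> R[i]) (t : R) M N : (M <= N)%N ->
  trig_poly a (sym_range N) z t - trig_poly a (sym_range M) z t =
  trig_poly a (sym_block M N) z t.
Proof. by move=> MN; rewrite /trig_poly -!sym_sumE sym_sumB. Qed.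

(** The only place where the covariance structure enters: the weighted bounded
    matrix makes the [L2] norm of a block comparable with the weighted [l2]
    norm of its coefficients. *)
Lemma block_second_moment (xi : int -> Omega -> R[i]) (gamma : int -> R[i]) (b : R)
    (a : int -> R[i]) :
  (forall n, L2 P setT (xi n)) ->
  (forall n m : int,
    cexpectation P (fun w => xi n w * conjc (xi m w)) = gamma (n - m)) ->
  l2_bounded_matrix (weighted_gamma gamma b) ->
  exists2 K : R, 0 <= K & forall (k N : nat) (t : R),
    (\int[P]_w (normc (trig_poly a (sym_block k N) (xi ^~ w) t) ^+ 2)%:E <=
     (K ^+ 2 * \sum_(n <- sym_block k N) normc (a n) ^+ 2 * `|n|%:~R `^ (2 * b))%:E)%E.
Proof.
move=> xiL2 cov /weighted_gamma_form[K K0 hK].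
exists (Num.sqrt K) => [|k N t]; first exact: sqrtr_ge0.
rewrite sqr_sqrtr ?(ltW K0)//.
pose c n := a n * cexpi (2 * pi * n%:~R * t).
have nc n : normc (c n) = normc (a n).
  by rewrite ComplexField.Normc.normcM normc_cexpi mulr1.
have s0 n : n \in sym_block k N -> n != 0.
  by rewrite mem_sym_block; case: eqP => // ->; rewrite absz0 ltn0.
have := hK (sym_block k N) (fun n => normc (a n)) (sym_block_uniq k N) s0
  (fun n => normc_ge0 (a n)).
rewrite -lee_fin; apply: le_trans.
have := second_moment_le (sym_block k N) c xiL2 cov.
under [in X in _ -> X]eq_integral => w _.
  rewrite /trig_poly (eq_bigr (fun n => c n * xi n w)).
    over.
  by move=> n _; rewrite /c mulrAC.
move=> /le_trans; apply; rewrite lee_fin le_eqVlt; apply/orP; left; apply/eqP.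
by apply: eq_bigr => n _; apply: eq_bigr => m _; rewrite !nc.
Qed.

End MainEstimate.

Theorem theorem4 (R : realType) (d : measure_display)
    (Omega : measurableType d) (P : probability Omega R)
    (xi : int -> Omega -> R[i]) (gamma : int -> R[i]) (b : R)
    (f : R -> R[i])
    (xi_gaussian : jointly_gaussian P xi)
    (xi_mean0 : forall n : int, cexpectation P (xi n) = 0)
    (xi_unit_variance : forall n : int,
       ('E_P[fun w => (normc (xi n w) ^+ 2)%R] = 1)%E)
    (xi_covariance : forall n m : int,
       cexpectation P (fun w => xi n w * conjc (xi m w)) = gamma (n - m))
    (xi_pseudo_covariance : forall n m : int,
       cexpectation P (fun w => xi n w * xi m w) = 0)
    (b_ge0 : 0 <= b)
    (gamma_bounded : l2_bounded_matrix (weighted_gamma gamma b))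
    (f_L2 : L2_circle f)
    (f_cond :
       (\esum_(n in [set n : int | (2 <= `|n|)%R])
          (sqrte (weighted_tail f b n) *
           ((`|n|%:~R * Num.sqrt (ln `|n|%:~R))^-1)%:E) < +oo)%E) :
  exists S : R -> Omega -> R[i],
    random_series_sum P f xi S /\ bounded_almost_surely P S.

Proof.
have [H [Hsub Hg Hxi]] := xi_gaussian.
have [HL2 _ _ _] := Hsub.
have xiL2 n : L2 P setT (xi n) by exact: HL2.
have cxi n : centered P (xi n) by apply: cexpectation_centered.
have xi1 n : (\int[P]_w (normc (xi n w) ^+ 2)%:E = 1)%E.
  by rewrite -(xi_unit_variance n) unlock.
pose a := fourier_coef f.
pose c (k : int) : R := normc (a k) ^+ 2 * `|k|%:~R `^ (2 * b).
have c0 k : 0 <= c k by rewrite mulr_ge0 ?sqr_ge0 ?powR_ge0.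
have [T [T0 Td Ttail [B TB]]] := tail_blocks c0 f_cond.
have [K K0 hK] := block_second_moment a xiL2 xi_covariance gamma_bounded.
have s2T k N t : (2 <= k)%N ->
    (\int[P]_w (normc (trig_poly a (sym_block k N) (xi ^~ w) t) ^+ 2)%:E <=
     (K ^+ 2 * T k ^+ 2)%:E)%E.
  move=> k2; apply: le_trans (hK k N t) _.
  rewrite lee_fin ler_wpM2l ?sqr_ge0//.
  apply: Ttail k2 (sym_block_uniq k N) _ => n.
  by rewrite mem_sym_block => /andP[/ltnW].
have aT k n : (2 <= k)%N -> (k <= `|n|)%N -> normc (a n) <= T k.
  move=> k2 kn; rewrite -ler_sqr ?nnegrE ?normc_ge0//.
  have := Ttail k [:: n] k2 isT; rewrite big_seq1.
  have h i : i \in [:: n] -> (k <= `|i|)%N by rewrite inE => /eqP ->.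
  move=> /(_ h); apply: le_trans; rewrite /c -[leLHS]mulr1 ler_wpM2l ?sqr_ge0//.
  have n1 : 1 <= `|n|%:~R :> R.
    by rewrite -abszE -pmulrn ler1n (leq_trans _ kn)// ltnW.
  by rewrite -[leLHS](powRr0 (`|n|%:~R : R)) ler_powR// mulr_ge0.
have [V [v [B' [mV vB' SV]]]] :=
  dyadic_blocks Hsub Hg Hxi cxi xi1 T0 K0 aT (fun k N t k2 _ => s2T k N t k2) TB.
pose X N t w := trig_poly a (sym_range N) (xi ^~ w) t.
have XH N t : H (X N t).
  by have [] := trig_poly_subspace a (sym_range N) t Hsub Hxi cxi.
have XL2 N t : L2 P setT (X N t) by exact: HL2.
have XE N t : random_partial_sum f xi t N = X N t.
  by apply/funext => w; rewrite /random_partial_sum sym_sumE.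
(* the series along the indices dyadic j converges uniformly *)
have [S [perS mS sepS bdS cvS]] : exists S : R -> Omega -> R[i],
    [/\ circle_process S, forall t, cmeasurable setT (S t),
        separable_process P S,
        \forall w \ae P, exists M : R, forall t, normc (S t w) <= M &
        \forall w \ae P, forall t,
          (fun j => normc (X (dyadic j) t w - S t w)) @ \oo --> (0 : R)].
  apply: (@uniform_limit_process _ _ _ P (fun j => X (dyadic j)) V v B') => //.
  - by move=> j t; have [] := XL2 (dyadic j) t.
  - by move=> j w t; rewrite /X -(trig_poly_periodic _ _ _ t 1).
  - move=> j w; exists (4 * pi * (dyadic j)%:R *
      (\sum_(n <- sym_range (dyadic j)) normc (a n) * normc (xi n w))) => s t.
    by apply: trig_poly_lipschitz => n; rewrite mem_sym_range.
  - move=> w; exists (\sum_(n <- sym_range (dyadic 0)) normc (a n) * normc (xi n w)) => t.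
    exact: normc_trig_poly.
  - move=> j w t; rewrite /X trig_poly_block; first exact: SV.
    exact: dyadic_mono.
(* let the upper end of the block N < |n| <= dyadic j tend to infinity *)
have dist N t : (2 <= N)%N ->
    (\int[P]_w (normc (X N t w - S t w) ^+ 2)%:E <= (K ^+ 2 * T N ^+ 2)%:E)%E.
  move=> N2.
  have Nd j : (N <= dyadic (j + N))%N.
    apply: ltnW; apply: leq_trans (ltn_expl N (ltnSn 1)) _.
    apply: leq_trans (ltnW (ltn_expl (2 ^ N) (ltnSn 1))) _.
    by apply: dyadic_mono; rewrite leq_addl.
  apply: (@L2_dist_limit_le _ _ _ P _ _ (fun j => X (dyadic (j + N)) t)) => //.
  - by have [] := XL2 N t.
  - by move=> j; have [] := XL2 (dyadic (j + N)) t.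
  - apply: filterS cvS => w /(_ t) cw.
    exact: (cvg_comp (fun j => (j + N)%N) _ (cvg_addnr N) cw).
  - move=> j; under eq_integral do rewrite -normcN opprB /X trig_poly_block//.
    exact: s2T.
have SL2 t : L2 P setT (S t) by apply: L2_of_dist (XL2 2%N t) (mS t) (dist 2%N t _).
exists S; split; last first.
  exists S; split=> // t; exact: nearW.
split=> // t; split; [by move=> N; rewrite XE|exact: SL2|].
have T2 : (fun N => (K ^+ 2 * T N ^+ 2)%:E) @ \oo --> 0%:E.
  apply: cvg_EFin; first exact: nearW.
  have cT := double_dyadic_tail_cvg0 T0 Td TB.
  rewrite -(mulr0 (K ^+ 2)) -[X in _ * X](mulr0 0).
  by apply: cvgM; [exact: cvg_cst|exact: cvgM].
apply: (squeeze_cvge _ (cvg_cst 0%E) T2); exists 2%N => // N /= N2.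
by rewrite XE dist// andbT; apply: integral_ge0 => w _; rewrite lee_fin sqr_ge0.
Qed.
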